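(* Let $\mathbf P\in\mathbb R^{3\times n}$ have columns linearly independent over $\mathbb Q$ and let $N$ be a positive integer. For each $\bm q$ let $\{\bm d_1(\bm q),\bm d_2(\bm q)\}$ be an orthonormal basis for the null space of $\bm q$ (the vectors $\bm v$ with $\bm q\cdot\bm v=0$). Then: (i) The space $\bm V^{\rm div0}_{N,{\rm qp}}:=\{\bm u\in H_{N,{\rm qp}}({\rm curl},\mathbb R^3): \nabla\cdot\bm u=0\}$ is a divergence-free (with respect to the operator $\nabla\cdot$) and $H_{\rm qp}({\rm curl},\mathbb R^3)$-conforming approximation space taking the form $$\bm V^{\rm div0}_{N,{\rm qp}}={\rm span}\big\{\bm\psi^j_{\bm q}(\bm z):=\bm d_j(\bm q)e^{{\rm i}\langle\bm q,\bm z\rangle}: j=1,2,\ \bm q\in\mathbb I_{{\rm qp},N}\big\}.$$ (ii) The corresponding divergence-free (with respect to the operator $\nabla_p\cdot$) and $H_{\rm per}(\nabla_p\times,\mathbb T^n)$-conforming approximation space $\bm V^{\rm div0}_{N,{\rm per}}:=\{\bm U\in H_{N,{\rm per}}(\nabla_{p}\times,\mathbb T^n):\nabla_{p}\cdot\bm U=0\}$ reads $$\bm V^{\rm div0}_{N,{\rm per}}={\rm span}\big\{\bm\Psi^j_{\bm k}(\bm x):=\bm d_j(\mathbf P\bm k)e^{{\rm i}\langle\bm k,\bm x\rangle}: j=1,2,\ \bm k\in\mathbb I_{{\rm per},N}\big\}.$$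
   Context: All spans are over $\mathbb C$; $\mathbb T^n=[0,2\pi]^n$ with periodic functions. Index sets: $\mathbb Z[{\rm col}(\mathbf P)]=\{\mathbf P\bm k:\bm k\in\mathbb Z^n\}$; $\phi(\bm k)=\mathbf P\bm k$ is a bijection $\mathbb Z^n\to\mathbb Z[{\rm col}(\mathbf P)]$; $\mathbb I_{{\rm per},N}=\{\bm k\in\mathbb Z^n:\|\bm k\|_\infty\le N\}$; $\mathbb I_{{\rm qp},N}=\{\bm q\in\mathbb Z[{\rm col}(\mathbf P)]:\|\phi^{-1}(\bm q)\|_\infty\le N\}$. Quasiperiodic functions: a function $f$ on $\mathbb R^3$ is quasiperiodic with projection matrix $\mathbf P$ if $f(\bm z)=F(\mathbf P^{\intercal}\bm z)$ with $F$ (the parent function) $2\pi$-periodic in each of $n$ variables. With the mean value $m(f)=\lim_{L\to\infty}(2L)^{-3}\int_{[-L,L]^3}f\,d\bm z$, set $(f,g)_{\rm qp}=m(f\bar g)$ and $\|f\|_{\rm qp}^2=(f,f)_{\rm qp}$; $L^2_{\rm qp}(\mathbb R^3)$ is the space of quasiperiodic functions (with respect to $\mathbf P$) with $\|f\|_{\rm qp}<\infty$. $H_{\rm qp}({\rm curl},\mathbb R^3)$ is the space of vector fields $\bm u\in L^2_{\rm qp}(\mathbb R^3)^3$ with $\nabla\times\bm u\in L^2_{\rm qp}(\mathbb R^3)^3$. ''Conforming'' means contained in the named space. Operators in $n$ variables: for $\bm F=(F_1,F_2,F_3)$ on $\mathbb T^n$, put $\partial^{(i)}=\sum_{l=1}^n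 P_{il}\partial_{x_l}$, $i=1,2,3$. Then $\nabla_p\times\bm F=(\partial^{(2)}F_3-\partial^{(3)}F_2,\ \partial^{(3)}F_1-\partial^{(1)}F_3,\ \partial^{(1)}F_2-\partial^{(2)}F_1)$ and $\nabla_p\cdot\bm F=\sum_{i=1}^3\partial^{(i)}F_i$. $H_{\rm per}(\nabla_p\times,\mathbb T^n)$ is the space of periodic $\bm F\in L^2_{\rm per}(\mathbb T^n)^3$ with $\nabla_p\times\bm F\in L^2_{\rm per}(\mathbb T^n)^3$. Truncated spaces ($\bm e_1,\bm e_2,\bm e_3$ the unit vectors of $\mathbb R^3$): $H_{N,{\rm qp}}({\rm curl},\mathbb R^3)={\rm span}\{e^{{\rm i}\langle\bm q,\bm z\rangle}\bm e_j: j=1,2,3,\ \bm q\in\mathbb I_{{\rm qp},N}\}$ and $H_{N,{\rm per}}(\nabla_p\times,\mathbb T^n)={\rm span}\{e^{{\rm i}\langle\bm k,\bm x\rangle}\bm e_j: j=1,2,3,\ \bm k\in\mathbb I_{{\rm per},N}\}$.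
   Formalization: At q = 0 the null space is all of ℂ³, so no two vectors form a basis of it; the formal statement takes three orthonormal vectors d_1, d_2, d_3 at q = 0 (two for every other q), and the spans range over all of them. *)

(* Defs.v *)
From HB Require Import structures.
From mathcomp Require Import all_boot all_order all_algebra.
From mathcomp Require Import all_classical all_reals all_analysis.
From mathcomp Require Import complex.

Set Implicit Arguments.
Unset Strict Implicit.
Unset Printing Implicit Defensive.

Import Order.TTheory GRing.Theory Num.Theory.
Import numFieldNormedType.Exports.

Local Open Scope classical_set_scope.
Local Open Scope ring_scope.
Local Open Scope complex_scope.

Definition col_display : measure_display -> measure_display.
Proof. exact. Qed.

(* Column vectors carry the sigma-algebra generated by the coordinate maps;
   on R^n this is the Borel sigma-algebra. *)
Section col_measurable.
Context {d} {T : measurableType d}.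
Variable n : nat.

Definition col_coord (i : 'I_n) (x : 'cV[T]_n) : T := x i ord0.

Let col_set0 : g_sigma_preimage col_coord set0.
Proof. exact: sigma_algebra0. Qed.

Let col_setC A : g_sigma_preimage col_coord A ->
  g_sigma_preimage col_coord (~` A).
Proof. exact: sigma_algebraC. Qed.

Let col_bigcup (F : _^nat) : (forall i, g_sigma_preimage col_coord (F i)) ->
  g_sigma_preimage col_coord (\bigcup_i (F i)).
Proof. exact: sigma_algebra_bigcup. Qed.

HB.instance Definition _ := @isMeasurable.Build (col_display d)
  'M[T]_(n, 1) (g_sigma_preimage col_coord) col_set0 col_setC col_bigcup.

End col_measurable.

Section col_measurable_theory.
Context {d d'} {T : measurableType d} {U : measurableType d'}.

Lemma measurable_col_coord n (i : 'I_n) :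
  measurable_fun [set: 'cV[T]_n] (col_coord i).
Proof.
move=> _ Y mY; rewrite setTI; apply: sub_sigma_algebra => /=.
rewrite -bigcup_seq/=; exists i => /=; first by rewrite mem_index_enum.
by exists Y => //; rewrite setTI.
Qed.

Lemma measurable_fun_colP n (f : U -> 'cV[T]_n) :
  (forall i, measurable_fun [set: U] (fun x => f x i ord0)) ->
  measurable_fun [set: U] f.
Proof.
move=> mf.
suff sub : g_sigma_preimage (fun i => @col_coord _ T n i \o f) `<=` measurable.
  move: sub; rewrite g_sigma_preimage_comp => sub _ A mA.
  by apply: sub; exists A.
apply: smallest_sub; first exact: sigma_algebra_measurable.
case: n => [|n] in f mf *; first by rewrite big_ord0.
rewrite -bigcup_mkord_ord; apply: bigcup_sub => i Ii.
by move=> A [B mB <-]; exact: mf.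
Qed.

End col_measurable_theory.

Section lebesgue_col.
Context {R : realType}.
Local Open Scope ereal_scope.

Definition col_cons n (tx : R * 'cV[R]_n) : 'cV[R]_n.+1 :=
  \col_i if unlift ord0 i is Some j then tx.2 j ord0 else tx.1.

Definition col_uncons n (x : 'cV[R]_n.+1) : R * 'cV[R]_n :=
  (x ord0 ord0, \col_j x (lift ord0 j) ord0).

Lemma col_consK n : cancel (@col_cons n) (@col_uncons n).
Proof.
move=> [t x]; rewrite /col_uncons /col_cons mxE unlift_none/=; congr pair.
by apply/colP => j; rewrite !mxE liftK.
Qed.

Lemma measurable_col_cons n : measurable_fun setT (@col_cons n).
Proof.
apply: measurable_fun_colP => i.
under eq_fun do rewrite mxE.
case: unliftP => [j _|_]; last exact: measurable_fst.
exact: (measurableT_comp (measurable_col_coord j) measurable_snd).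
Qed.

Lemma measurable_col_uncons n : measurable_fun setT (@col_uncons n).
Proof.
apply: measurable_fun_pair; first exact: measurable_col_coord.
apply: measurable_fun_colP => i.
under eq_fun do rewrite mxE.
exact: measurable_col_coord.
Qed.

Section step.
Variables (n : nat) (mu : {sigma_finite_measure set 'cV[R]_n -> \bar R}).

Definition lebesgue_col_step : set 'cV[R]_n.+1 -> \bar R :=
  pushforward (@lebesgue_measure R \x mu) (@col_cons n).

Let step0 : lebesgue_col_step set0 = 0.
Proof. by rewrite /lebesgue_col_step /pushforward preimage_set0 measure0. Qed.

Let step_ge0 A : 0 <= lebesgue_col_step A.
Proof. by rewrite /lebesgue_col_step /pushforward measure_ge0. Qed.

Let step_sigma_additive : semi_sigma_additive lebesgue_col_step.
Proof.
move=> F mF tF mUF; rewrite /lebesgue_col_step /pushforward preimage_bigcup.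
have mpre A : measurable A -> measurable (@col_cons n @^-1` A).
  by move=> mA; rewrite -[X in measurable X]setTI; exact: measurable_col_cons.
apply: measure_semi_sigma_additive => [k| |]; first exact: mpre.
- apply/trivIsetP => /= i j _ _ ij; rewrite -preimage_setI.
  by move/trivIsetP : tF => /(_ _ _ _ _ ij) ->//; rewrite preimage_set0.
- by rewrite -preimage_bigcup; exact: mpre.
Qed.

HB.instance Definition _ := isMeasure.Build _ _ _
  lebesgue_col_step step0 step_ge0 step_sigma_additive.

Let step_sigma_finite : sigma_finite setT lebesgue_col_step.
Proof.
have /sigma_finiteP[F [TF ndF Foo]] := sigma_finiteT (@lebesgue_measure R).
have /sigma_finiteP[G [TG ndG Goo]] := sigma_finiteT mu.
have FGT : setT = \bigcup_k (F k `*` G k).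
  apply/seteqP; split => // -[x y] _.
  have [k _ Fkx] : (\bigcup_k F k) x by rewrite -TF.
  have [l _ Gly] : (\bigcup_k G k) y by rewrite -TG.
  exists (maxn k l) => //; split => /=.
  - by move: x Fkx; exact/subsetPset/ndF/leq_maxl.
  - by move: y Gly; exact/subsetPset/ndG/leq_maxr.
exists (fun k => @col_uncons n @^-1` (F k `*` G k)).
  by rewrite -preimage_bigcup -FGT preimage_setT.
move=> k; have [mF Fk] := Foo k; have [mG Gk] := Goo k; split.
  rewrite -[X in measurable X]setTI; apply: measurable_col_uncons => //.
  exact: measurableX.
rewrite /lebesgue_col_step /pushforward -comp_preimage.
rewrite (_ : _ \o _ = id); last by apply/funext => x; exact: col_consK.
by rewrite preimage_id product_measure1E// lte_mul_pinfty// ge0_fin_numE.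
Qed.

HB.instance Definition _ := Measure_isSigmaFinite.Build _ _ _
  lebesgue_col_step step_sigma_finite.

End step.

(* n-dimensional Lebesgue measure: R^n.+1 is identified with R * R^n, and R^0
   is a point of mass 1. *)
Fixpoint lebesgue_col n : {sigma_finite_measure set 'cV[R]_n -> \bar R} :=
  match n with
  | 0%N => dirac (0%R : 'cV[R]_0)
  | n'.+1 => lebesgue_col_step (lebesgue_col n')
  end.

End lebesgue_col.

Definition lin_span (K : nzRingType) (V : lmodType K) (S : set V) : set V :=
  [set v | exists (m : nat) (c : 'I_m -> K) (w : 'I_m -> V),
      (forall i, S (w i)) /\ v = \sum_(i < m) c i *: w i].

Section complex_functions.
Context {R : realType}.
Local Notation C := R[i].

Definition expi (t : R) : C := cos t +i* sin t.

Definition dotr n (x y : 'cV[R]_n) : R := \sum_i x i ord0 * y i ord0.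

Definition unitv n (l : 'I_n) : 'cV[R]_n := delta_mx l ord0.

Definition periodic n (T : Type) (F : 'cV[R]_n -> T) : Prop :=
  forall x l, F (x + (2 * pi) *: unitv l) = F x.

Section integration.
Context {d} {T : measurableType d}.

Definition cmeasurable (f : T -> C) : Prop :=
  measurable_fun setT (fun x => complex.Re (f x)) /\
  measurable_fun setT (fun x => complex.Im (f x)).

Variable mu : {measure set T -> \bar R}.

Definition cintegrable (A : set T) (f : T -> C) : Prop :=
  mu.-integrable A (fun x => (complex.Re (f x))%:E) /\
  mu.-integrable A (fun x => (complex.Im (f x))%:E).

Definition cintegral (A : set T) (f : T -> C) : C :=
  Rintegral mu A (fun x => complex.Re (f x)) +i*
  Rintegral mu A (fun x => complex.Im (f x)).

End integration.

Section derivatives.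
Variable n : nat.

Definition partial (l : 'I_n) (g : 'cV[R]_n -> R) : 'cV[R]_n -> R :=
  fun x => 'D_(unitv l) g x.

Definition cpartial (l : 'I_n) (f : 'cV[R]_n -> C) : 'cV[R]_n -> C :=
  fun x => partial l (fun y => complex.Re (f y)) x +i*
           partial l (fun y => complex.Im (f y)) x.

(* C^infinity: all iterated partial derivatives exist and are continuous. *)
Definition smooth (g : 'cV[R]_n -> R) : Prop :=
  forall s : seq 'I_n, let h := foldr partial g s in
    continuous h /\ (forall l x, derivable h x (unitv l)).

Definition smooth_field (Phi : 'cV[R]_n -> 'cV[C]_3) : Prop :=
  forall j, smooth (fun x => complex.Re (Phi x j ord0)) /\
            smooth (fun x => complex.Im (Phi x j ord0)).

End derivatives.

Section vector_calculus.
Variables (X : Type) (D : 'I_3 -> (X -> C) -> X -> C).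

Definition comp3 (u : X -> 'cV[C]_3) (j : nat) : X -> C :=
  fun x => u x (inord j) ord0.

Definition divergence (u : X -> 'cV[C]_3) : X -> C :=
  fun x => \sum_j D j (fun y => u y j ord0) x.

Definition curl (u : X -> 'cV[C]_3) : X -> 'cV[C]_3 :=
  let d i j := D (inord i) (comp3 u j) in
  fun x => \col_(i < 3) [:: d 1%N 2%N x - d 2%N 1%N x;
                            d 2%N 0%N x - d 0%N 2%N x;
                            d 0%N 1%N x - d 1%N 0%N x]`_i.

End vector_calculus.

(* The derivation d^(i) = \sum_l P_il d/dx_l on functions of n variables. *)
Definition partialP n (P : 'M[R]_(3, n)) (i : 'I_3) (f : 'cV[R]_n -> C) :
    'cV[R]_n -> C :=
  fun x => \sum_l (P i l)%:C * cpartial l f x.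

(* w is the curl of u in the sense of distributions on A, the test fields
   being those in Test (bilinear pairing, no conjugation):
   \int_A u . (curl Phi) = \int_A w . Phi. *)
Definition weak_curl n (D : 'I_3 -> ('cV[R]_n -> C) -> 'cV[R]_n -> C)
    (A : set 'cV[R]_n) (Test : set ('cV[R]_n -> 'cV[C]_3))
    (u w : 'cV[R]_n -> 'cV[C]_3) : Prop :=
  forall Phi, Test Phi ->
    cintegral (lebesgue_col n) A
      (fun x => \sum_j u x j ord0 * curl D Phi x j ord0) =
    cintegral (lebesgue_col n) A
      (fun x => \sum_j w x j ord0 * Phi x j ord0).

End complex_functions.

Section index_sets.
Context {R : realType} (n : nat).
Implicit Types (P : 'M[R]_(3, n)) (N : nat).

Definition rationally_independent_columns P : Prop :=
  forall a : 'cV[rat]_n, P *m map_mx ratr a = 0 -> a = 0.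

Definition phi P (k : 'cV[int]_n) : 'cV[R]_3 := P *m map_mx intr k.

Definition Zcol P : set 'cV[R]_3 := range (phi P).

Definition I_per N : set 'cV[int]_n :=
  [set k | forall i, `|k i ord0| <= N%:Z].

(* phi P is injective when the columns of P are rationally independent, so that
   the image of I_per is the set of q in Z[col(P)] with |phi^-1(q)| <= N. *)
Definition I_qp P N : set 'cV[R]_3 := phi P @` I_per N.

End index_sets.

Section spaces.
Context {R : realType}.
Local Notation C := R[i].

Section periodic_spaces.
Variables (n : nat) (P : 'M[R]_(3, n)).

Definition torus : set 'cV[R]_n :=
  [set x | forall i, 0 <= x i ord0 <= 2 * pi].

Definition L2_per (F : 'cV[R]_n -> C) : Prop :=
  [/\ periodic F, cmeasurable F &
    (\int[lebesgue_col n]_(x in torus) (ComplexField.Normc.normc (F x) ^+ 2)%:E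
       < +oo)%E].

Definition L2_per3 (F : 'cV[R]_n -> 'cV[C]_3) : Prop :=
  forall j, L2_per (fun x => F x j ord0).

Definition Hcurl_per : set ('cV[R]_n -> 'cV[C]_3) :=
  [set F | L2_per3 F /\ exists2 W, L2_per3 W &
     weak_curl (partialP P) torus
       [set Phi | smooth_field Phi /\ periodic Phi] F W].

Definition HN_per (N : nat) : set ('cV[R]_n -> 'cV[C]_3) :=
  lin_span [set U | exists j k, I_per N k /\
    U = fun x => expi (dotr (map_mx intr k) x) *: delta_mx j ord0].

Definition Vdiv0_per (N : nat) : set ('cV[R]_n -> 'cV[C]_3) :=
  [set U | HN_per N U /\ forall x, divergence (partialP P) U x = 0].

End periodic_spaces.

Section quasiperiodic_spaces.
Variables (n : nat) (P : 'M[R]_(3, n)).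

Definition quasiperiodic (f : 'cV[R]_3 -> C) : Prop :=
  exists F : 'cV[R]_n -> C, periodic F /\ forall z, f z = F (P^T *m z).

Definition cube (L : R) : set 'cV[R]_3 :=
  [set z | forall i, - L <= z i ord0 <= L].

Definition cube_average (f : 'cV[R]_3 -> C) (L : R) : C :=
  ((2 * L) ^- 3)%:C * cintegral (lebesgue_col 3) (cube L) f.

(* m(f) exists and equals c. *)
Definition is_mean_value (f : 'cV[R]_3 -> C) (c : C) : Prop :=
  [/\ forall L, cintegrable (lebesgue_col 3) (cube L) f,
      complex.Re (cube_average f L) @[L --> +oo] --> complex.Re c &
      complex.Im (cube_average f L) @[L --> +oo] --> complex.Im c].

Definition is_qp_inner (f g : 'cV[R]_3 -> C) (c : C) : Prop :=
  is_mean_value (fun z => f z * (g z)^*) c.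

Definition L2_qp (f : 'cV[R]_3 -> C) : Prop :=
  [/\ quasiperiodic f, cmeasurable f & exists c, is_qp_inner f f c].

Definition L2_qp3 (u : 'cV[R]_3 -> 'cV[C]_3) : Prop :=
  forall j, L2_qp (fun z => u z j ord0).

Definition Hcurl_qp : set ('cV[R]_3 -> 'cV[C]_3) :=
  [set u | L2_qp3 u /\ exists2 w, L2_qp3 w &
     weak_curl (@cpartial R 3) setT
       [set Phi | smooth_field Phi /\ compact (closure [set z | Phi z != 0])]
       u w].

Definition HN_qp (N : nat) : set ('cV[R]_3 -> 'cV[C]_3) :=
  lin_span [set u | exists j q, I_qp P N q /\
    u = fun z => expi (dotr q z) *: delta_mx j ord0].

Definition Vdiv0_qp (N : nat) : set ('cV[R]_3 -> 'cV[C]_3) :=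
  [set u | HN_qp N u /\ forall z, divergence (@cpartial R 3) u z = 0].

End quasiperiodic_spaces.

Definition null_space (q : 'cV[R]_3) : set 'cV[C]_3 :=
  [set v | \sum_i (q i ord0)%:C * v i ord0 = 0].

(* The dimension of null_space q: the null space of q = 0 is the whole of C^3,
   so that an orthonormal basis of it has three elements and not two. *)
Definition null_dim (q : 'cV[R]_3) : nat := if q == 0 then 3 else 2.

Definition orthonormal_basis m (e : 'I_m -> 'cV[C]_3) (S : set 'cV[C]_3) :
    Prop :=
  (forall a b, \sum_i e a i ord0 * (e b i ord0)^* = (a == b)%:R) /\
  lin_span (range e) = S.

End spaces.

(* Main.v *)
(* Both cases are instances of one situation: the derivations
   [partialP M i] on R^m with M of size 3 x m act on the character
   exp(i<a, x>) as multiplication by i (M a)_i; the quasiperiodic case is m = 3,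
   M = 1, the periodic one is m = n, M = P.  Distinct characters are linearly
   independent, so a trigonometric polynomial sum_a exp(i<a, x>) c_a has
   divergence 0 iff each c_a is orthogonal to M a.  For conformity, the classical
   curl of such a field is again a trigonometric polynomial, and it is the weak
   curl because u . curl Phi - Phi . curl u = div (Phi x u), whose integral over a
   box vanishes when the boundary terms cancel (periodicity) or are zero (compact
   support).  The same integration over a box bounds the integral of a nontrivial
   character over the cube of side 2L by O(L^2), whence its mean value is 0. *)
Require Import Defs.
From mathcomp Require Import all_boot all_order all_algebra.
From mathcomp Require Import all_classical all_reals all_analysis.
From mathcomp Require Import complex.
From mathcomp Require Import measurable_realfun ring lra.
Import Order.TTheory GRing.Theory Num.Theory.
Import numFieldNormedType.Exports.
Local Open Scope classical_set_scope.
Local Open Scope ring_scope.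
Local Open Scope complex_scope.

Set Implicit Arguments.
Unset Strict Implicit.
Unset Printing Implicit Defensive.

(** * Continuous functions on boxes *)

Section boxes.
Context {R : realType}.

Definition box n (a b : R) : set 'cV[R]_n :=
  [set x | forall i, a <= x i ord0 <= b].
Arguments box : clear implicits.

Lemma near_col n (x : 'cV[R]_n) (A : set 'cV[R]_n) :
  nbhs x A ->
  exists2 e : R, 0 < e &
    forall y : 'cV[R]_n, (forall i, `|x i ord0 - y i ord0| < e) -> A y.
Proof.
move=> /nbhs_ballP[e /= e0 xA]; exists e => // y xy; apply: xA; split => // i j.
by rewrite [j]ord1; exact: xy.
Qed.

Lemma measurable_itv_prod n (I : 'I_n -> interval R) :
  measurable [set x : 'cV[R]_n | forall i, x i ord0 \in I i].
Proof.
rewrite (_ : mkset _ = \big[setI/setT]_(i < n) (@col_coord _ R n i @^-1` [set` I i])).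
  apply: bigsetI_measurable => i _.
  by rewrite -[X in measurable X]setTI; exact: measurable_col_coord.
rewrite -bigcap_seq; apply/seteqP; split => y /= By i => [_|]; first exact: By.
by apply: By; rewrite /= mem_index_enum.
Qed.

(** The sigma-algebra on columns is generated by the coordinate maps and not by the open sets, so
    the open preimage of a ray is exhibited as a countable union of open cubes with rational centre
    and radius. *)
Lemma continuous_measurable_col n (g : 'cV[R]_n -> R) :
  continuous g -> measurable_fun setT g.
Proof.
move=> /continuousP cg.
apply: (measurability _ (RGenOInfty.measurableE R)).
move=> _ [_ [a ->] <-]; rewrite setTI.
have oU : open (g @^-1` `]a, +oo[) by apply: cg; exact: interval_open.
set U := _ @^-1` _ in oU *.
pose B (p : 'cV[rat]_n * rat) : set 'cV[R]_n :=
  [set y | forall i, y i ord0 \in `]ratr (p.1 i ord0) - ratr p.2,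
                                   ratr (p.1 i ord0) + ratr p.2[].
pose D := [set p | B p `<=` U].
rewrite (_ : U = \bigcup_(p in D) B p).
  rewrite bigcup_mkcond; apply: countable_bigcupT_measurable => // p.
  by case: ifP => // _; exact: measurable_itv_prod.
apply/seteqP; split => [x Ux|x [p Dp]]; last exact: Dp.
have [e e0 xU] : exists2 e : R, 0 < e &
    forall y : 'cV[R]_n, (forall i, `|x i ord0 - y i ord0| < e) -> U y.
  by apply: near_col; move: Ux; rewrite openE in oU; exact: oU.
(* With a radius [r < e / 2] and a rational centre within [r] of [x], every point of the cube is
   within [2 r < e] of [x], hence in [U]. *)
have [r] := @rat_in_itvoo R 0 (e / 2) (divr_gt0 e0 (ltr0n _ 2)).
rewrite in_itv/= => /andP[r0 re].
have /choice[q qP] : forall i : 'I_n, exists q, (ratr q : R) \in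
    `](x i ord0 - ratr r), (x i ord0 + ratr r)[.
  by move=> i; apply: rat_in_itvoo; rewrite ltrD2l (lt_trans _ r0)// oppr_lt0.
have xq i : `|x i ord0 - ratr (q i)| < ratr r.
  by have := qP i; rewrite in_itv/= ltr_norml => /andP[? ?]; apply/andP; split; lra.
exists (\col_i q i, r).
  move=> y By; apply: xU => i; have := By i; have := xq i.
  by rewrite !mxE in_itv/= !ltr_norml => /andP[? ?] /andP[? ?]; apply/andP; split; lra.
move=> i; have := xq i; rewrite !mxE in_itv/= ltr_norml => /andP[? ?].
by apply/andP; split; lra.
Qed.

Lemma measurable_box n (a b : R) : measurable (box n a b).
Proof.
rewrite (_ : box _ _ _ = [set x : 'cV[R]_n | forall i, x i ord0 \in `[a, b]]).
  exact: measurable_itv_prod.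
by apply/seteqP; split => x bx i; have := bx i; rewrite /= in_itv.
Qed.

(** The box is the image under the continuous transposition of a product of segments in the row
    vectors, which is compact. *)
Lemma compact_box n (a b : R) : compact (box n a b).
Proof.
rewrite (_ : box _ _ _ =
    trmx @` [set v : 'rV[R]_n | forall i, `[a, b]%classic (v ord0 i)]).
  apply: continuous_compact; last first.
    by apply: (@rV_compact R n (fun=> `[a, b]%classic)) => i; exact: segment_compact.
  apply: continuous_subspaceT => v A /nbhs_ballP[e e0 vA].
  apply/nbhs_ballP; exists e => // w [_ vw]; apply: vA; split => // i j.
  by rewrite !mxE; exact: vw.
apply/seteqP; split => [x bx|_ [v bv <-] i].
  by exists x^T; [move=> i /=; rewrite mxE in_itv/=; exact: bx|rewrite trmxK].
by have := bv i; rewrite /= in_itv/= mxE.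
Qed.

Lemma bounded_on_box n (a b : R) (g : 'cV[R]_n -> R) : continuous g ->
  exists2 M : R, 0 < M & forall x, box n a b x -> `|g x| <= M.
Proof.
move=> cg.
have /compact_bounded[M [_ MP]] : compact (g @` box n a b).
  by apply: continuous_compact; [exact: continuous_subspaceT|exact: compact_box].
exists (`|M| + 1) => [|x bx]; first by rewrite ltr_wpDl.
by apply: (MP (`|M| + 1)); [rewrite ltr_pwDr ?ler_norm|exists x].
Qed.

Lemma box_col_cons n (a b : R) :
  @col_cons R n @^-1` box n.+1 a b = `[a, b]%classic `*` box n a b.
Proof.
apply/seteqP; split => -[t x] /=.
  move=> tx; split => [|i].
    by have := tx ord0; rewrite mxE unlift_none in_itv.
  by have := tx (lift ord0 i); rewrite mxE liftK.
move=> [tab bx] i; rewrite mxE; case: unliftP => [j _|_]; first exact: bx.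
by move: tab; rewrite in_itv.
Qed.

Lemma lebesgue_box n (a b : R) : a <= b ->
  lebesgue_col n (box n a b) = ((b - a) ^+ n)%:E.
Proof.
move=> ab; elim: n => [|n IHn].
  by rewrite expr0/= diracE mem_set// => -[].
rewrite /= /lebesgue_col_step /pushforward box_col_cons.
rewrite product_measure1E//; last exact: measurable_box.
rewrite [X in (X * _)%E]lebesgue_measure_itv IHn/= lte_fin.
by case: ltgtP ab => // [ab _|-> _];
  rewrite ?exprS ?EFinM// subrr ?mul0r ?mul0e.
Qed.

Lemma lebesgue_box_lty n (a b : R) : (lebesgue_col n (box n a b) < +oo)%E.
Proof.
have [ab|ba] := leP a b; first by rewrite lebesgue_box ?ltry.
(* For [b < a] the box is empty except in dimension 0, where it is the whole one-point space of mass
   1. *)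
case: n => [|n]; first by rewrite /= diracE; case: (_ \in _); rewrite ?ltry.
rewrite (_ : box _ _ _ = set0) ?measure0//; apply/seteqP; split => // x /(_ ord0).
by move=> /andP[ax xb]; move: (le_lt_trans (le_trans ax xb) ba); rewrite ltxx.
Qed.

Lemma integrable_box n (a b : R) (g : 'cV[R]_n -> R) : continuous g ->
  (lebesgue_col n).-integrable (box n a b) (EFin \o g).
Proof.
move=> cg; apply: measurable_bounded_integrable.
- exact: measurable_box.
- exact: lebesgue_box_lty.
- by apply: measurable_funTS; exact: continuous_measurable_col.
have [M M0 gM] := bounded_on_box a b cg.
exists M; split; first exact: num_real.
by move=> y My x /= bx; exact: le_trans (gM _ bx) (ltW My).
Qed.

(** Fubini for the product measure that [lebesgue_col] pushes forward along [col_cons]. Both orders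
    serve below: the first coordinate outermost for an induction on the dimension, innermost for the
    fundamental theorem of calculus. *)
Lemma integral_box_cons n (a b : R) (g : 'cV[R]_n.+1 -> R) : continuous g ->
  (\int[lebesgue_col n.+1]_(x in box n.+1 a b) (g x)%:E =
   \int[lebesgue_measure]_(t in `[a, b])
     \int[lebesgue_col n]_(x in box n a b) (g (col_cons (t, x)))%:E)%E /\
  (\int[lebesgue_col n.+1]_(x in box n.+1 a b) (g x)%:E =
   \int[lebesgue_col n]_(x in box n a b)
     \int[lebesgue_measure]_(t in `[a, b]) (g (col_cons (t, x)))%:E)%E.
Proof.
move=> cg.
have mg := continuous_measurable_col cg.
pose D : set (measurableTypeR R * 'cV[R]_n)%type := `[a, b]%classic `*` box n a b.
have mD : measurable D by apply: measurableX => //; exact: measurable_box.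
pose m : {measure set (measurableTypeR R * 'cV[R]_n)%type -> \bar R} :=
  (@lebesgue_measure R \x lebesgue_col n)%E.
have mgc : measurable_fun setT (g \o @col_cons R n).
  by apply: measurableT_comp => //; exact: measurable_col_cons.
have mcc : measurable_fun setT
    (@col_cons R n : measurableTypeR R * 'cV[R]_n -> 'cV[R]_n.+1).
  exact: measurable_col_cons.
have intg : m.-integrable D (EFin \o (g \o @col_cons R n)).
  apply: measurable_bounded_integrable => //.
  - rewrite [X in (X < _)%E](_ : _ = lebesgue_measure `[a, b]%classic *
      lebesgue_col n (box n a b))%E; last first.
      by apply: product_measure1E => //; exact: measurable_box.
    apply: lte_mul_pinfty => //; last exact: lebesgue_box_lty.
    by rewrite ge0_fin_numE// lebesgue_measure_itv/=; case: ifP; rewrite ?ltry.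
  - exact: measurable_funTS.
  have [M M0 gM] := bounded_on_box a b cg.
  exists M; split; first exact: num_real.
  move=> y My p Dp; apply: le_trans (ltW My); apply: gM.
  by move: Dp; rewrite /D -box_col_cons.
have E1 : (\int[lebesgue_col n.+1]_(x in box n.+1 a b) (g x)%:E =
    \int[m]_(p in D) (g (col_cons p))%:E)%E.
  rewrite (@integral_pushforward _ _ _ _ R _ mcc m
    (box n.+1 a b) (EFin \o g)).
  - by rewrite box_col_cons.
  - exact/measurable_EFinP.
  - by rewrite box_col_cons.
  - exact: measurable_box.
(* Fubini is applied on the whole product to the extension by zero from [D]; the indicator of [D] is
   then split again into those of its two factors. *)
have intgT : m.-integrable setT ((fun p => (g (col_cons p))%:E) \_ D).
  by rewrite -integrable_mkcond.
rewrite E1 integral_mkcond; split.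
  rewrite -integral12_prod_meas1// [RHS]integral_mkcond; apply: eq_integral => t _.
  rewrite /fubini_F patchE; case: ifPn => [|tab].
    rewrite inE => tab; rewrite [RHS]integral_mkcond; apply: eq_integral => x _.
    rewrite !patchE; congr (if _ then _ else _).
    by apply/idP/idP; rewrite !inE /D /=; [case|].
  rewrite integral0_eq// => x _; rewrite patchE ifF//.
  by apply/negP; rewrite inE => -[/= tab' _]; move/negP: tab; apply; rewrite inE.
rewrite -integral21_prod_meas1// [RHS]integral_mkcond; apply: eq_integral => x _.
rewrite /fubini_G patchE; case: ifPn => [|xb].
  rewrite inE => xb; rewrite [RHS]integral_mkcond; apply: eq_integral => t _.
  rewrite !patchE; congr (if _ then _ else _).
  by apply/idP/idP; rewrite !inE /D /=; [case|].
rewrite integral0_eq// => t _; rewrite patchE ifF//.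
by apply/negP; rewrite inE => -[/= _ xb']; move/negP: xb; apply; rewrite inE.
Qed.

End boxes.

Arguments box {R} n a b.

(** * Partial derivatives *)

Section partial_derivatives.
Context {R : realType}.

(** A directional derivative sees a function only along a line, so functions on different spaces
    that agree along two parametrised lines have the same one. *)
Lemma derive_line (V W : normedModType R) (f : V -> R) (g : W -> R) a v b w :
  (forall h, f (h *: v + a) = g (h *: w + b)) ->
  (derivable f a v <-> derivable g b w) /\ 'D_v f a = 'D_w g b.
Proof.
move=> fg; rewrite /derivable /derive.
have fg0 : f a = g b by have := fg 0; rewrite !scale0r !add0r.
set f1 := (X in lim (X @ _) = _); set g1 := (X in _ = lim (X @ _)).
have E : f1 = g1 by apply/funext => h; rewrite /f1 /g1 /= fg fg0.
by rewrite -/f1 -/g1 E.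
Qed.

Definition C1 n (g : 'cV[R]_n -> R) := continuous g /\
  forall l, continuous (partial l g) /\ forall x, derivable g x (unitv l).

Section C1_closure.
Variable n : nat.
Implicit Types f g : 'cV[R]_n -> R.

Lemma partialD f g l x : C1 f -> C1 g ->
  partial l (fun y => f y + g y) x = partial l f x + partial l g x.
Proof. by move=> [_ /(_ l)[_ df]] [_ /(_ l)[_ dg]]; exact: deriveD. Qed.

Lemma partialM f g l x : C1 f -> C1 g ->
  partial l (fun y => f y * g y) x = f x * partial l g x + g x * partial l f x.
Proof. by move=> [_ /(_ l)[_ df]] [_ /(_ l)[_ dg]]; exact: deriveM. Qed.

Lemma partialN f l x : C1 f -> partial l (fun y => - f y) x = - partial l f x.
Proof. by move=> [_ /(_ l)[_ df]]; exact: deriveN. Qed.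

Lemma continuousTD f g : continuous f -> continuous g ->
  continuous (fun x => f x + g x).
Proof. by move=> cf cg x; apply: continuousD; [exact: cf|exact: cg]. Qed.

Lemma continuousTM f g : continuous f -> continuous g ->
  continuous (fun x => f x * g x).
Proof. by move=> cf cg x; apply: continuousM; [exact: cf|exact: cg]. Qed.

Lemma continuousTN f : continuous f -> continuous (fun x => - f x).
Proof. by move=> cf x; apply: continuousN; exact: cf. Qed.

Lemma C1D f g : C1 f -> C1 g -> C1 (fun y => f y + g y).
Proof.
move=> Cf Cg; split=> [|l]; first by apply: continuousTD; [case: Cf|case: Cg].
have [[_ /(_ l)[cf df]] [_ /(_ l)[cg dg]]] := (Cf, Cg).
split=> [|x]; last exact: derivableD.
rewrite (_ : partial _ _ = fun x => partial l f x + partial l g x).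
  exact: continuousTD.
by apply/funext => x; exact: partialD.
Qed.

Lemma C1M f g : C1 f -> C1 g -> C1 (fun y => f y * g y).
Proof.
move=> Cf Cg; split=> [|l]; first by apply: continuousTM; [case: Cf|case: Cg].
have [[cf /(_ l)[cf' df]] [cg /(_ l)[cg' dg]]] := (Cf, Cg).
split=> [|x]; last exact: derivableM.
rewrite (_ : partial _ _ = fun x => f x * partial l g x + g x * partial l f x).
  by apply: continuousTD; exact: continuousTM.
by apply/funext => x; exact: partialM.
Qed.

Lemma C1N f : C1 f -> C1 (fun y => - f y).
Proof.
move=> Cf; split=> [|l]; first by apply: continuousTN; case: Cf.
have [_ /(_ l)[cf df]] := Cf.
split=> [|x]; last exact: derivableN.
rewrite (_ : partial _ _ = fun x => - partial l f x); first exact: continuousTN.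
by apply/funext => x; exact: partialN.
Qed.

Lemma partial_cst (c : R) l x : partial l (fun _ : 'cV[R]_n => c) x = 0.
Proof. exact: derive_cst. Qed.

Lemma C1_cst (c : R) : C1 (fun _ : 'cV[R]_n => c).
Proof.
split=> [|l]; first exact: cst_continuous.
split=> [|x]; last exact: derivable_cst.
rewrite (_ : partial _ _ = cst 0); first exact: cst_continuous.
by apply/funext => x; exact: partial_cst.
Qed.

Lemma smooth_C1 f : smooth f -> C1 f.
Proof.
move=> sf; have /= [cf df] := sf [::]; split => // l; split => [|x]; last exact: df.
by have /= [] := sf [:: l].
Qed.

End C1_closure.

(** For [s] an endpoint of the box, this is the projection of [x] onto a face; it expresses the
    boundary terms of integration by parts. *)
Definition upd n (x : 'cV[R]_n) (l : 'I_n) (s : R) : 'cV[R]_n :=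
  \col_i if i == l then s else x i ord0.

Lemma continuous_upd n (l : 'I_n) s : continuous (fun x => upd x l s).
Proof.
move=> x A /nbhs_ballP[e /= e0 xA]; apply/nbhs_ballP; exists e => // y [_ xy].
apply: xA; split => // i j; rewrite !mxE; case: ifP => // _; exact: ballxx.
Qed.

Lemma col_cons_shift0 n h t (x : 'cV[R]_n) :
  h *: unitv ord0 + col_cons (t, x) = col_cons (h + t, x).
Proof.
apply/colP => i; rewrite !mxE; case: unliftP => [j ->|->]/=.
  by rewrite mulr0 add0r.
by rewrite mulr1.
Qed.

Lemma col_cons_shift n h t (x : 'cV[R]_n) l :
  h *: unitv (lift ord0 l) + col_cons (t, x) = col_cons (t, h *: unitv l + x).
Proof.
apply/colP => i; rewrite !mxE; case: unliftP => [j ->|->]/=.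
  by rewrite !mxE !eqxx (inj_eq lift_inj).
by rewrite mulr0 add0r.
Qed.

Lemma upd_col_cons0 n t (x : 'cV[R]_n) s :
  upd (col_cons (t, x)) ord0 s = col_cons (s, x).
Proof.
apply/colP => i; rewrite !mxE; case: unliftP => [j ->|->]; last by rewrite eqxx.
by rewrite eq_sym (negbTE (neq_lift _ _)).
Qed.

Lemma upd_col_cons n t (x : 'cV[R]_n) l s :
  upd (col_cons (t, x)) (lift ord0 l) s = col_cons (t, upd x l s).
Proof.
apply/colP => i; rewrite !mxE; case: unliftP => [j ->|->].
  by rewrite !mxE (inj_eq lift_inj).
by rewrite (negbTE (neq_lift _ _)).
Qed.

Lemma continuous_col_cons1 n t : continuous (fun x : 'cV[R]_n => col_cons (t, x)).
Proof.
move=> x A /nbhs_ballP[e /= e0 xA]; apply/nbhs_ballP; exists e => // y [_ xy].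
apply: xA; split => // i j; rewrite !mxE.
by case: unliftP => [k _|_]; [exact: xy|exact: ballxx].
Qed.

Lemma continuous_col_cons2 n (x : 'cV[R]_n) : continuous (fun t => col_cons (t, x)).
Proof.
move=> t A /nbhs_ballP[e /= e0 xA]; apply/nbhs_ballP; exists e => // s ts.
apply: xA; split => // i j; rewrite !mxE.
by case: unliftP => [k _|_]; [exact: ballxx|exact: ts].
Qed.

Lemma derive_col_cons n (g : 'cV[R]_n.+1 -> R) t x l :
  (derivable g (col_cons (t, x)) (unitv (lift ord0 l)) <->
   derivable (fun y => g (col_cons (t, y))) x (unitv l)) /\
  partial (lift ord0 l) g (col_cons (t, x)) =
  partial l (fun y => g (col_cons (t, y))) x.
Proof. by apply: derive_line => h; rewrite col_cons_shift. Qed.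

Lemma C1_col_cons n (g : 'cV[R]_n.+1 -> R) t :
  C1 g -> C1 (fun y => g (col_cons (t, y))).
Proof.
move=> [cg dg]; split => [x|l].
  by apply: continuous_comp; [exact: continuous_col_cons1|exact: cg].
have {dg}[cg' dg] := dg (lift ord0 l); split => [|x].
  rewrite (_ : partial _ _ = partial (lift ord0 l) g \o (fun x => col_cons (t, x))).
    move=> x; apply: continuous_comp; [exact: continuous_col_cons1|exact: cg'].
  by apply/funext => x /=; rewrite (derive_col_cons _ _ _ _).2.
exact/(derive_col_cons _ _ _ _).1.
Qed.

(* The boundary terms of the fundamental theorem of calculus are averaged over
   the missing coordinate, so that both sides are integrals over the same box. *)
Lemma integral_box_partial n (l : 'I_n) (a b : R) (g : 'cV[R]_n -> R) :
  a < b -> C1 g ->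
  (\int[lebesgue_col n]_(x in box n a b) (partial l g x)%:E =
   \int[lebesgue_col n]_(x in box n a b)
     ((g (upd x l b) - g (upd x l a)) / (b - a))%:E)%E.
Proof.
move=> ab; elim: n l g => [[]//|n IHn] l g Cg.
have [cg dg] := Cg; have [cg' dgl] := dg l.
have cD : continuous (fun x => (g (upd x l b) - g (upd x l a)) / (b - a)).
  have cu s : continuous (fun x => g (upd x l s)).
    by move=> x; apply: continuous_comp; [exact: continuous_upd|exact: cg].
  apply: continuousTM; last exact: cst_continuous.
  by apply: continuousTD => //; exact: continuousTN.
(* If [l] is not the first coordinate, the induction hypothesis applies to each slice with the first
   coordinate fixed. *)
case: (unliftP ord0 l) cg' dgl cD => [j ->|->] cg' dgl cD.
  rewrite (integral_box_cons a b cg').1 (integral_box_cons a b cD).1.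
  apply: eq_integral => t _.
  under eq_integral do rewrite (derive_col_cons _ _ _ _).2.
  rewrite IHn; last exact: C1_col_cons.
  by apply: eq_integral => x _; rewrite !upd_col_cons.
(* If [l] is the first coordinate, it is integrated innermost, where the one-variable fundamental
   theorem of calculus applies to [G]. *)
rewrite (integral_box_cons a b cg').2 (integral_box_cons a b cD).2.
apply: eq_integral => x _.
pose G t := g (col_cons (t, x)).
have dG (t : R) : is_derive t (1 : R) G (partial ord0 g (col_cons (t, x))).
  have [|dGg DGg] := @derive_line _ _ G g t 1 (col_cons (t, x)) (unitv ord0).
    by move=> h; rewrite col_cons_shift0 /G [_ *: 1]mulr1.
  by split; [exact/dGg|exact: DGg].
have cG : continuous G.
  by move=> t; apply: continuous_comp; [exact: continuous_col_cons2|exact: cg].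
rewrite (@continuous_FTC2 _ _ G) //.
(* The averaged increment does not depend on the integration variable; multiplied by the length
   [b - a] it gives back the increment of [G]. *)
- under eq_integral do rewrite !upd_col_cons0.
  rewrite integral_cst//= [X in (_ * X)%E]lebesgue_measure_itv/= lte_fin ab.
  by rewrite -EFinB -EFinM divfK// subr_eq0 gt_eqF.
- apply: continuous_subspaceT => t.
  by apply: continuous_comp; [exact: continuous_col_cons2|exact: cg'].
- split => [t _||]; first exact: ex_derive.
  + exact/cvg_at_right_filter/cG.
  + exact/cvg_at_left_filter/cG.
- by move=> t _; rewrite derive1E; exact: derive_val.
Qed.

Lemma integral_box_partial0 n (l : 'I_n) (a b : R) (g : 'cV[R]_n -> R) :
  a < b -> C1 g -> (forall x, g (upd x l b) = g (upd x l a)) ->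
  \int[lebesgue_col n]_(x in box n a b) partial l g x = 0.
Proof.
move=> ab Cg gab; rewrite /Rintegral integral_box_partial// integral0_eq// => x _.
by rewrite gab subrr mul0r.
Qed.

End partial_derivatives.

(** * Complex-valued functions *)

Section complex_valued.
Context {R : realType}.
Local Notation C := R[i].
Local Notation Re := complex.Re.
Local Notation Im := complex.Im.

Lemma Re_mul (x y : C) : Re (x * y) = Re x * Re y - Im x * Im y.
Proof. by case: x; case: y. Qed.

Lemma Im_mul (x y : C) : Im (x * y) = Re x * Im y + Re y * Im x.
Proof. by case: x => a b; case: y => c d /=; rewrite (mulrC b c). Qed.

Lemma Re_add (x y : C) : Re (x + y) = Re x + Re y.
Proof. by case: x; case: y. Qed.

Lemma Im_add (x y : C) : Im (x + y) = Im x + Im y.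
Proof. by case: x; case: y. Qed.

Lemma Re_opp (x : C) : Re (- x) = - Re x.
Proof. by case: x. Qed.

Lemma Im_opp (x : C) : Im (- x) = - Im x.
Proof. by case: x. Qed.

Lemma complexP (x y : C) : Re x = Re y -> Im x = Im y -> x = y.
Proof. by case: x; case: y => a b c d /= -> ->. Qed.

(** Regularity is imposed on real and imaginary parts separately, which is also how [cpartial] and
    [cintegral] are built. *)
Definition ccontinuous n (f : 'cV[R]_n -> C) :=
  continuous (fun x => Re (f x)) /\ continuous (fun x => Im (f x)).

Definition cC1 n (f : 'cV[R]_n -> C) :=
  C1 (fun x => Re (f x)) /\ C1 (fun x => Im (f x)).

Section closure.
Variable n : nat.
Implicit Types f g : 'cV[R]_n -> C.

Lemma ccontinuous_cst c : ccontinuous (fun _ : 'cV[R]_n => c).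
Proof. by split; exact: cst_continuous. Qed.

Lemma ccontinuousD f g : ccontinuous f -> ccontinuous g ->
  ccontinuous (fun x => f x + g x).
Proof.
move=> [f1 f2] [g1 g2]; split.
  by under eq_fun do rewrite Re_add; exact: continuousTD.
by under eq_fun do rewrite Im_add; exact: continuousTD.
Qed.

Lemma ccontinuousM f g : ccontinuous f -> ccontinuous g ->
  ccontinuous (fun x => f x * g x).
Proof.
move=> [f1 f2] [g1 g2]; split.
  under eq_fun do rewrite Re_mul; apply: continuousTD; first exact: continuousTM.
  by apply: continuousTN; exact: continuousTM.
by under eq_fun do rewrite Im_mul; apply: continuousTD; exact: continuousTM.
Qed.

Lemma ccontinuousN f : ccontinuous f -> ccontinuous (fun x => - f x).
Proof.
move=> cf; under eq_fun do rewrite -mulN1r.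
by apply: ccontinuousM => //; exact: ccontinuous_cst.
Qed.

Lemma ccontinuous_sum (I : Type) (r : seq I) (F : I -> 'cV[R]_n -> C) :
  (forall i, ccontinuous (F i)) -> ccontinuous (fun x => \sum_(i <- r) F i x).
Proof.
move=> cF; elim: r => [|i r IHr].
  by under eq_fun do rewrite big_nil; exact: (ccontinuous_cst 0).
by under eq_fun do rewrite big_cons; exact: ccontinuousD.
Qed.

Lemma cC1_ccontinuous f : cC1 f -> ccontinuous f.
Proof. by move=> [[? _] [? _]]. Qed.

Lemma cC1_cst c : cC1 (fun _ : 'cV[R]_n => c).
Proof. by split; exact: C1_cst. Qed.

Lemma cC1D f g : cC1 f -> cC1 g -> cC1 (fun x => f x + g x).
Proof.
move=> [f1 f2] [g1 g2]; split.
  by under eq_fun do rewrite Re_add; exact: C1D.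
by under eq_fun do rewrite Im_add; exact: C1D.
Qed.

Lemma cC1M f g : cC1 f -> cC1 g -> cC1 (fun x => f x * g x).
Proof.
move=> [f1 f2] [g1 g2]; split.
  under eq_fun do rewrite Re_mul; apply: C1D; first exact: C1M.
  by apply: C1N; exact: C1M.
by under eq_fun do rewrite Im_mul; apply: C1D; exact: C1M.
Qed.

Lemma cC1N f : cC1 f -> cC1 (fun x => - f x).
Proof.
move=> [f1 f2]; split; first by under eq_fun do rewrite Re_opp; exact: C1N.
by under eq_fun do rewrite Im_opp; exact: C1N.
Qed.

Lemma cC1_sum (I : Type) (r : seq I) (F : I -> 'cV[R]_n -> C) :
  (forall i, cC1 (F i)) -> cC1 (fun x => \sum_(i <- r) F i x).
Proof.
move=> cF; elim: r => [|i r IHr].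
  by under eq_fun do rewrite big_nil; exact: (cC1_cst 0).
by under eq_fun do rewrite big_cons; exact: cC1D.
Qed.

Lemma cpartialD f g l x : cC1 f -> cC1 g ->
  cpartial l (fun y => f y + g y) x = cpartial l f x + cpartial l g x.
Proof.
move=> [f1 f2] [g1 g2]; apply: complexP; rewrite /cpartial ?Re_add ?Im_add /=.
  by under eq_fun do rewrite Re_add; rewrite partialD.
by under eq_fun do rewrite Im_add; rewrite partialD.
Qed.

Lemma cpartialM f g l x : cC1 f -> cC1 g ->
  cpartial l (fun y => f y * g y) x = f x * cpartial l g x + g x * cpartial l f x.
Proof.
move=> [f1 f2] [g1 g2].
apply: complexP; rewrite /cpartial ?(Re_add, Im_add) ?(Re_mul, Im_mul) /=.
  under eq_fun do rewrite Re_mul.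
  rewrite partialD; [|exact: C1M|by apply: C1N; exact: C1M].
  rewrite partialN; last exact: C1M.
  by rewrite !partialM//; ring.
under eq_fun do rewrite Im_mul.
rewrite partialD; [|exact: C1M|exact: C1M].
by rewrite !partialM//; ring.
Qed.

Lemma cpartial_cst c l x : cpartial l (fun _ : 'cV[R]_n => c) x = 0.
Proof. by apply: complexP; rewrite /= partial_cst. Qed.

Lemma ccontinuous_cpartial f l : cC1 f -> ccontinuous (cpartial l f).
Proof. by move=> [[_ /(_ l)[? _]] [_ /(_ l)[? _]]]. Qed.

Variable M : 'M[R]_(3, n).

Lemma partialPD i f g x : cC1 f -> cC1 g ->
  partialP M i (fun y => f y + g y) x = partialP M i f x + partialP M i g x.
Proof.
move=> f1 g1; rewrite /partialP -big_split; apply: eq_bigr => l _ /=.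
by rewrite cpartialD// mulrDr.
Qed.

Lemma partialPM i f g x : cC1 f -> cC1 g ->
  partialP M i (fun y => f y * g y) x = f x * partialP M i g x + g x * partialP M i f x.
Proof.
move=> f1 g1; rewrite /partialP !big_distrr -big_split; apply: eq_bigr => l _ /=.
by rewrite cpartialM//; ring.
Qed.

Lemma partialP_cst i c x : partialP M i (fun _ => c) x = 0.
Proof. by rewrite /partialP big1// => l _; rewrite cpartial_cst mulr0. Qed.

Lemma partialPZ i c f x : cC1 f ->
  partialP M i (fun y => c * f y) x = c * partialP M i f x.
Proof.
by move=> f1; rewrite (partialPM _ _ (cC1_cst c) f1) partialP_cst mulr0 addr0.
Qed.

Lemma partialPB i f g x : cC1 f -> cC1 g ->
  partialP M i (fun y => f y - g y) x = partialP M i f x - partialP M i g x.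
Proof.
move=> f1 g1; rewrite (partialPD _ _ f1 (cC1N g1)).
by under [in X in _ + X]eq_fun do rewrite -mulN1r; rewrite (partialPZ _ _ _ g1) mulN1r.
Qed.

Lemma partialP_sum i (I : Type) (r : seq I) (F : I -> 'cV[R]_n -> C) x :
  (forall k, cC1 (F k)) ->
  partialP M i (fun y => \sum_(k <- r) F k y) x = \sum_(k <- r) partialP M i (F k) x.
Proof.
move=> cF; elim: r => [|k r IHr].
  by under eq_fun do rewrite big_nil; rewrite big_nil partialP_cst.
under eq_fun do rewrite big_cons.
by rewrite big_cons partialPD// ?IHr//; exact: cC1_sum.
Qed.

Lemma ccontinuous_partialP i f : cC1 f -> ccontinuous (partialP M i f).
Proof.
move=> f1; apply: ccontinuous_sum => l; apply: ccontinuousM.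
  exact: ccontinuous_cst.
exact: ccontinuous_cpartial.
Qed.

End closure.

(** Makes the ordinary partial derivatives on R^3 an instance of [partialP], so that the
    quasiperiodic case falls under the general statements. *)
Lemma partialP1 : partialP (1%:M : 'M[R]_3) = @cpartial R 3.
Proof.
apply/funext => i; apply/funext => f; apply/funext => x.
rewrite /partialP (bigD1 i)//= mxE eqxx mul1r big1 ?addr0// => l li.
by rewrite mxE eq_sym (negbTE li) mul0r.
Qed.

Lemma big_ord3 (V : nmodType) (F : 'I_3 -> V) :
  \sum_j F j = F (inord 0) + F (inord 1) + F (inord 2).
Proof.
rewrite !big_ord_recl big_ord0 addr0 addrA.
by congr (F _ + F _ + F _); apply: val_inj; rewrite /= inordK.
Qed.

(** * The divergence of a cross product *)

Section curl_identity.
Variables (n : nat) (M : 'M[R]_(3, n)).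
Local Notation D := (partialP M).
Implicit Types u v : 'cV[R]_n -> 'cV[C]_3.

Definition cC1_field u := forall j, cC1 (fun x => u x j ord0).

Definition cross u v : 'I_3 -> 'cV[R]_n -> C := fun i x =>
  [:: comp3 u 1 x * comp3 v 2 x - comp3 u 2 x * comp3 v 1 x;
      comp3 u 2 x * comp3 v 0 x - comp3 u 0 x * comp3 v 2 x;
      comp3 u 0 x * comp3 v 1 x - comp3 u 1 x * comp3 v 0 x]`_i.

Lemma cC1_cross u v i : cC1_field u -> cC1_field v -> cC1 (cross u v i).
Proof.
move=> u1 v1.
have uv j k : cC1 (fun x => comp3 u j x * comp3 v k x - comp3 u k x * comp3 v j x).
  by apply: cC1D; [|apply: cC1N]; apply: cC1M; [exact: u1|exact: v1|exact: u1|exact: v1].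
by case: i => -[|[|[|//]]] i3; exact: uv.
Qed.

Lemma ccontinuous_curl u j : cC1_field u -> ccontinuous (fun x => curl D u x j ord0).
Proof.
move=> u1.
have uv (i k : 'I_3) (j' k' : nat) : 
    ccontinuous (fun x => D i (comp3 u j') x - D k (comp3 u k') x).
  by apply: ccontinuousD; [|apply: ccontinuousN]; apply: ccontinuous_partialP; exact: u1.
under eq_fun do rewrite mxE.
by case: j => -[|[|[|//]]] i3; exact: uv.
Qed.

(** This is div (u x v) = v . curl u - u . curl v. It needs only the product rule, hence holds for
    the derivations given by any matrix [M]. *)
Lemma div_cross u v x : cC1_field u -> cC1_field v ->
  \sum_j v x j ord0 * curl D u x j ord0 =
  \sum_j curl D v x j ord0 * u x j ord0 + \sum_i D i (cross u v i) x.
Proof.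
move=> u1 v1.
have uc j : cC1 (comp3 u j) by exact: u1.
have vc j : cC1 (comp3 v j) by exact: v1.
have DB i j k : D i (fun x => comp3 u j x * comp3 v k x - comp3 u k x * comp3 v j x) x =
    comp3 u j x * D i (comp3 v k) x + comp3 v k x * D i (comp3 u j) x -
    (comp3 u k x * D i (comp3 v j) x + comp3 v j x * D i (comp3 u k) x).
  rewrite (partialPB _ _ _ (cC1M (uc j) (vc k)) (cC1M (uc k) (vc j))).
  by rewrite (partialPM _ _ _ (uc j) (vc k)) (partialPM _ _ _ (uc k) (vc j)).
have cE (w : 'cV[R]_n -> 'cV[C]_3) j : w x (inord j) ord0 = comp3 w j x by [].
rewrite !big_ord3 /cross !mxE !inordK//= !DB !cE.
(* Derivatives first, then values, are generalised to free variables, which leaves a polynomial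
   identity. *)
do !match goal with |- context[D ?i (comp3 ?w ?j) x] =>
  move: (D i (comp3 w j) x) end.
do !match goal with |- context[comp3 ?w ?j x] => move: (comp3 w j x) end.
move=> *; ring.
Qed.

End curl_identity.
End complex_valued.

(** * Weak curls *)

Section complex_integral.
Context {R : realType}.
Local Notation C := R[i].
Local Notation Re := complex.Re.
Local Notation Im := complex.Im.

(** * Linearity of the complex integral *)

Section general.
Context d (T : measurableType d).
Variables (mu : {measure set T -> \bar R}) (A : set T).
Hypothesis mA : measurable A.
Implicit Types f g : T -> C.

Lemma cintegrableD f g : cintegrable mu A f -> cintegrable mu A g ->
  cintegrable mu A (fun x => f x + g x).
Proof.
move=> [f1 f2] [g1 g2]; split.
  rewrite (_ : (fun x => _) = (fun x => (Re (f x))%:E + (Re (g x))%:E)%E).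
    exact: integrableD.
  by apply/funext => x; rewrite Re_add EFinD.
rewrite (_ : (fun x => _) = (fun x => (Im (f x))%:E + (Im (g x))%:E)%E).
  exact: integrableD.
by apply/funext => x; rewrite Im_add EFinD.
Qed.

Lemma cintegralD f g : cintegrable mu A f -> cintegrable mu A g ->
  cintegral mu A (fun x => f x + g x) = cintegral mu A f + cintegral mu A g.
Proof.
move=> [f1 f2] [g1 g2]; rewrite /cintegral; apply: complexP => /=.
  by rewrite -RintegralD//; apply: eq_Rintegral => x _; rewrite Re_add.
by rewrite -RintegralD//; apply: eq_Rintegral => x _; rewrite Im_add.
Qed.

Lemma cintegrableZ (c : C) f : cintegrable mu A f -> cintegrable mu A (fun x => c * f x).
Proof.
move=> [f1 f2]; split.
  rewrite (_ : (fun x => _) =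
      (fun x => (Re c)%:E * (Re (f x))%:E - (Im c)%:E * (Im (f x))%:E)%E).
    by apply: integrableB => //; exact: integrableZl.
  by apply/funext => x; rewrite Re_mul EFinB !EFinM.
rewrite (_ : (fun x => _) =
    (fun x => (Re c)%:E * (Im (f x))%:E + (Im c)%:E * (Re (f x))%:E)%E).
  by apply: integrableD => //; exact: integrableZl.
by apply/funext => x; rewrite Im_mul EFinD !EFinM [((Re (f x))%:E * _)%E]muleC.
Qed.

Lemma cintegralZ (c : C) f : cintegrable mu A f ->
  cintegral mu A (fun x => c * f x) = c * cintegral mu A f.
Proof.
move=> [f1 f2]; rewrite /cintegral; apply: complexP; rewrite ?Re_mul ?Im_mul /=.
  rewrite -!RintegralZl// -RintegralB//; last 2 first.
  - by rewrite (_ : _ \o _ = (fun x => (Re c)%:E * (Re (f x))%:E)%E)//; exact: integrableZl.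
  - by rewrite (_ : _ \o _ = (fun x => (Im c)%:E * (Im (f x))%:E)%E)//; exact: integrableZl.
  by apply: eq_Rintegral => x _; rewrite Re_mul.
rewrite [X in _ = _ + X]mulrC -!RintegralZl// -RintegralD//; last 2 first.
- by rewrite (_ : _ \o _ = (fun x => (Re c)%:E * (Im (f x))%:E)%E)//; exact: integrableZl.
- by rewrite (_ : _ \o _ = (fun x => (Im c)%:E * (Re (f x))%:E)%E)//; exact: integrableZl.
by apply: eq_Rintegral => x _; rewrite Im_mul [Im c * _]mulrC.
Qed.

Lemma cintegral0 : cintegral mu A (fun=> 0 : C) = 0.
Proof. by rewrite /cintegral !Rintegral_cst// !mul0r. Qed.

End general.

(** * Integration by parts on a box *)

Section on_box.
Variables (n : nat) (a b : R).
Local Notation cint := (cintegral (lebesgue_col n) (box n a b)).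

Lemma cintegrable_box (f : 'cV[R]_n -> C) : ccontinuous f ->
  cintegrable (lebesgue_col n) (box n a b) f.
Proof. by move=> [f1 f2]; split; exact: integrable_box. Qed.

Lemma cintegral_box_sum (I : Type) (r : seq I) (F : I -> 'cV[R]_n -> C) :
  (forall i, ccontinuous (F i)) ->
  cint (fun x => \sum_(i <- r) F i x) = \sum_(i <- r) cint (F i).
Proof.
move=> cF; elim: r => [|i r IHr].
  under [X in cint X]eq_fun do rewrite big_nil.
  by rewrite big_nil cintegral0//; exact: measurable_box.
under [X in cint X]eq_fun do rewrite big_cons.
rewrite big_cons -IHr cintegralD//; first exact: measurable_box.
  exact: cintegrable_box.
by apply: cintegrable_box; exact: ccontinuous_sum.
Qed.

Lemma cintegral_partialP0 (M : 'M[R]_(3, n)) i (f : 'cV[R]_n -> C) :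
  a < b -> cC1 f -> (forall x l, f (upd x l b) = f (upd x l a)) ->
  cint (partialP M i f) = 0.
Proof.
move=> ab f1 fab; rewrite /partialP cintegral_box_sum; last first.
  move=> l; apply: ccontinuousM; first exact: ccontinuous_cst.
  exact: ccontinuous_cpartial.
rewrite big1// => l _.
rewrite cintegralZ; [|exact: measurable_box|]; last first.
  by apply: cintegrable_box; exact: ccontinuous_cpartial.
have [fR fI] := f1.
rewrite /cintegral /= !(integral_box_partial0 (l := l))// ?mulr0//.
  by move=> x; rewrite fab.
by move=> x; rewrite fab.
Qed.

(** By [div_cross] the two integrands differ by the divergence of Phi x u. The boundary condition
    bears on products of components, so that it follows either from periodicity of both fields or
    from the vanishing of [Phi] alone on the faces. *)
Lemma weak_curl_box (M : 'M[R]_(3, n)) (u Phi : 'cV[R]_n -> 'cV[C]_3) :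
  a < b -> cC1_field u -> cC1_field Phi ->
  (forall x l j k, Phi (upd x l b) j ord0 * u (upd x l b) k ord0 =
                   Phi (upd x l a) j ord0 * u (upd x l a) k ord0) ->
  cint (fun x => \sum_j u x j ord0 * curl (partialP M) Phi x j ord0) =
  cint (fun x => \sum_j curl (partialP M) u x j ord0 * Phi x j ord0).
Proof.
move=> ab u1 P1 uP.
under [X in cint X]eq_fun do rewrite div_cross//.
rewrite cintegralD; first last.
- apply: cintegrable_box; apply: ccontinuous_sum => i; apply: ccontinuous_partialP.
  exact: cC1_cross.
- apply: cintegrable_box; apply: ccontinuous_sum => i; apply: ccontinuousM.
    exact: ccontinuous_curl.
  exact: cC1_ccontinuous.
- exact: measurable_box.
rewrite cintegral_box_sum; last first.
  by move=> i; apply: ccontinuous_partialP; exact: cC1_cross.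
rewrite [X in _ + X]big1 ?addr0// => i _.
apply: cintegral_partialP0 => //; first exact: cC1_cross.
move=> x l; rewrite /cross /comp3.
by case: i => -[|[|[|//]]] i3 /=; rewrite !uP.
Qed.

End on_box.

Lemma cC1_smooth_field n (Phi : 'cV[R]_n -> 'cV[C]_3) : smooth_field Phi -> cC1_field Phi.
Proof. by move=> sP j; have [? ?] := sP j; split; exact: smooth_C1. Qed.

Lemma periodic_upd n (T : Type) (F : 'cV[R]_n -> T) x l  : Defs.periodic F ->
  F (upd x l (2 * pi)) = F (upd x l 0).
Proof.
move=> /(_ (upd x l 0) l) <-; congr F; apply/colP => i; rewrite !mxE andbT.
by case: eqP => _; rewrite ?mulr1 ?mulr0 ?add0r ?addr0.
Qed.

Lemma torus_box n : @torus R n = box n 0 (2 * pi).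
Proof. by []. Qed.

Lemma weak_curl_per n (M : 'M[R]_(3, n)) (u : 'cV[R]_n -> 'cV[C]_3) :
  cC1_field u -> Defs.periodic u ->
  weak_curl (partialP M) (@torus R n)
    [set Phi | smooth_field Phi /\ Defs.periodic Phi] u (curl (partialP M) u).
Proof.
move=> u1 pu Phi [/cC1_smooth_field P1 pP]; rewrite torus_box.
apply: weak_curl_box => //; first by rewrite mulr_gt0// pi_gt0.
by move=> x l j k; rewrite !periodic_upd.
Qed.

Lemma cintegral_supp n (a b : R) (f : 'cV[R]_n -> C) :
  (forall x, ~ box n a b x -> f x = 0) ->
  cintegral (lebesgue_col n) setT f = cintegral (lebesgue_col n) (box n a b) f.
Proof.
move=> f0; rewrite /cintegral [in RHS]Rintegral_mkcond [X in _ = _ +i* X]Rintegral_mkcond.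
congr (_ +i* _); apply: eq_Rintegral => x _; rewrite patchE; case: ifPn => //;
  by rewrite notin_setE => /f0 ->.
Qed.

(** The integrals over the whole space reduce to a cube whose interior contains the support of
    [Phi]; the boundary terms then vanish whatever [u] is there. *)
Lemma weak_curl_supp (M : 'M[R]_3) (u : 'cV[R]_3 -> 'cV[C]_3) :
  cC1_field u ->
  weak_curl (partialP M) setT
    [set Phi | smooth_field Phi /\ compact (closure [set z | Phi z != 0])]
    u (curl (partialP M) u).
Proof.
move=> u1 Phi [/cC1_smooth_field P1 /compact_bounded[K [_ KP]]].
set S := closure _ in KP.
(* Boundedness holds for every constant above [K]; this one is also positive. *)
pose L := `|K| + 1.
have L0 : 0 < L by rewrite ltr_wpDl.
have SL x : S x -> forall i, `|x i ord0| <= L.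
  move=> Sx i; have /KP/(_ x Sx) : K < L by rewrite ltr_pwDr ?ler_norm.
  apply: le_trans; rewrite [leRHS](_ : _ = mx_norm x)// mx_normrE.
  exact: (le_bigmax _ (fun ij => `|x ij.1 ij.2|) (i, ord0)).
have Phi0 x : ~ S x -> Phi x = 0.
  by move=> nSx; apply: contrapT => /eqP Px; apply: nSx; exact: subset_closure.
(* One more unit of room puts the faces of the cube strictly outside the support. *)
pose a := - (L + 1); pose b := L + 1.
have bS x : S x -> forall i, a < x i ord0 < b.
  move=> Sx i; have := SL x Sx i; rewrite ler_norml /a /b => /andP[? ?].
  by apply/andP; split; lra.
have nb x : ~ box 3 a b x -> ~ S x.
  by move=> nbx Sx; apply: nbx => i; have /andP[/ltW-> /ltW->] := bS x Sx i.
(* Since [S] is closed, [Phi] vanishes on a whole neighbourhood of a point off [S], and so do its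
   derivatives at that point. *)
have ca x : ~ S x -> forall j, curl (partialP M) Phi x j ord0 = 0.
  move=> nSx.
  have nx : \forall y \near x, Phi y = 0.
    have oS : open (~` S) by apply: closed_openC; exact: closed_closure.
    by move: oS; rewrite openE => /(_ x nSx); apply: filterS => y; exact: Phi0.
  have c0 l j : cpartial l (comp3 Phi j) x = 0.
    rewrite -[RHS](cpartial_cst 0 l x); apply: complexP; rewrite /= /partial;
      apply: near_eq_derive; apply: filterS nx => y; rewrite /comp3 => ->;
      by rewrite mxE.
  have p0 i j : partialP M i (comp3 Phi j) x = 0.
    by rewrite /partialP big1// => l _; rewrite c0 mulr0.
  by move=> j; rewrite mxE !p0 subrr; case: j => -[|[|[|//]]].
rewrite !(@cintegral_supp 3 a b).
- apply: weak_curl_box => //; first by rewrite /a /b; lra.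
  move=> x l j k.
  have n1 s : s = a \/ s = b -> Phi (upd x l s) = 0.
    move=> sE; apply: Phi0 => /bS/(_ l); rewrite mxE eqxx.
    by case: sE => ->; rewrite ltxx ?andbF.
  by rewrite !n1 ?mxE ?mul0r//; [left|right].
- by move=> x /nb nSx; rewrite big1// => j _; rewrite (Phi0 _ nSx) [X in _ * X]mxE mulr0.
- by move=> x /nb nSx; rewrite big1// => j _; rewrite (ca _ nSx) mulr0.
Qed.

End complex_integral.

(** * Trigonometric polynomials *)

Section trigonometric_polynomials.
Context {R : realType}.
Local Notation C := R[i].
Local Notation Re := complex.Re.
Local Notation Im := complex.Im.

Lemma expiD (s t : R) : expi (s + t) = expi s * expi t.
Proof. by apply: complexP; rewrite ?Re_mul ?Im_mul /= ?cosD ?sinD//; ring. Qed.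

Lemma expi0 : expi (0 : R) = 1.
Proof. by rewrite /expi cos0 sin0. Qed.

Lemma expipi : expi (pi : R) = -1.
Proof. by apply: complexP; rewrite /= ?cospi ?sinpi ?oppr0. Qed.

Lemma expi_neq0 (t : R) : expi t != 0.
Proof.
apply/eqP => e0; have := expiD t (- t).
by rewrite subrr expi0 e0 mul0r => /eqP; rewrite oner_eq0.
Qed.

Lemma expi2pi (k : int) : expi (2 * pi * k%:~R : R) = 1.
Proof.
have nat2pi n : expi (2 * pi * n%:R : R) = 1.
  elim: n => [|n IHn]; first by rewrite mulr0 expi0.
  rewrite [n.+1%:R](_ : _ = n%:R + 1); last by rewrite natr1.
  rewrite mulrDr expiD IHn mulr1 mul1r.
  by rewrite (_ : 2 * pi = pi + pi); [rewrite expiD expipi mulrNN mulr1|ring].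
case: (intP k) => [|n|n]; first by rewrite mulr0 expi0.
  exact: nat2pi.
have := expiD (2 * pi * n.+1%:R) (2 * pi * (- n.+1%:Z)%:~R : R).
by rewrite nat2pi mul1r => <-; rewrite rmorphN mulrN subrr expi0.
Qed.

Lemma dotrE n (x y : 'cV[R]_n) : dotr x y = (x^T *m y) ord0 ord0.
Proof. by rewrite mxE; apply: eq_bigr => i _; rewrite mxE. Qed.

Lemma dotrDr n (a x y : 'cV[R]_n) : dotr a (x + y) = dotr a x + dotr a y.
Proof. by rewrite !dotrE mulmxDr mxE. Qed.

Lemma dotrZr n (a x : 'cV[R]_n) t : dotr a (t *: x) = t * dotr a x.
Proof. by rewrite !dotrE -scalemxAr mxE. Qed.

Lemma dotrBl n (a b x : 'cV[R]_n) : dotr (a - b) x = dotr a x - dotr b x.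
Proof. by rewrite !dotrE raddfB/= mulmxBl !mxE. Qed.

Lemma dotr0r n (a : 'cV[R]_n) : dotr a 0 = 0.
Proof. by rewrite dotrE mulmx0 mxE. Qed.

Lemma dotr0l n (x : 'cV[R]_n) : dotr 0 x = 0.
Proof. by rewrite dotrE trmx0 mul0mx mxE. Qed.

Lemma dotr_unitv n (a : 'cV[R]_n) l : dotr a (unitv l) = a l ord0.
Proof.
rewrite /dotr (bigD1 l)//= mxE !eqxx mulr1 big1 ?addr0// => i il.
by rewrite mxE (negbTE il) mulr0.
Qed.

Lemma dotr_mulmx m n (A : 'M[R]_(m, n)) x z : dotr (A *m x) z = dotr x (A^T *m z).
Proof. by rewrite !dotrE trmx_mul mulmxA. Qed.

Lemma dotr_eq0 n (a : 'cV[R]_n) : dotr a a = 0 -> a = 0.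
Proof.
move=> aa; apply/colP => i; rewrite mxE; apply/eqP; rewrite -sqrf_eq0 expr2.
have /psumr_eq0P/(_ aa)/(_ i isT) : forall j : 'I_n, true -> 0 <= a j ord0 * a j ord0.
  by move=> j _; rewrite -expr2 sqr_ge0.
by move=> ->.
Qed.

Lemma continuous_dotr n (a : 'cV[R]_n) : continuous (dotr a).
Proof.
rewrite /dotr; elim: (index_enum _) => [|i r IHr].
  by under eq_fun do rewrite big_nil; exact: cst_continuous.
under eq_fun do rewrite big_cons.
apply: continuousTD => //; apply: continuousTM; first exact: cst_continuous.
exact: coord_continuous.
Qed.

(** Along a line in the direction [unitv l], [dotr a] is affine with slope [a l ord0], so the
    derivative is one of [h] in one variable. A general [h] covers both cosine and sine. *)
Lemma C1_dotr n (a : 'cV[R]_n) (h h' : R -> R) : continuous h' ->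
  (forall t : R, is_derive t (1 : R) h (h' t)) ->
  C1 (fun x => h (dotr a x)) /\
  forall l x, partial l (fun x => h (dotr a x)) x = a l ord0 * h' (dotr a x).
Proof.
move=> ch' dh.
have diffh t : differentiable h t by apply/derivable1_diffP; exact: ex_derive.
have lineE l x : (derivable (fun x => h (dotr a x)) x (unitv l) <->
    derivable h (dotr a x) (a l ord0)) /\
    'D_(unitv l) (fun x => h (dotr a x)) x = 'D_(a l ord0) h (dotr a x).
  by apply: derive_line => s; rewrite dotrDr dotrZr dotr_unitv.
have pE l x : partial l (fun x => h (dotr a x)) x = a l ord0 * h' (dotr a x).
  rewrite /partial (lineE l x).2 deriveE// deriv1E; last exact: ex_derive.
  by rewrite derive1E derive_val.
split=> //; split => [x|l].
  apply: continuous_comp; first exact: continuous_dotr.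
  exact/differentiable_continuous.
split=> [|x]; last by apply/(lineE l x).1; exact: diff_derivable.
rewrite (_ : partial _ _ = fun x => a l ord0 * h' (dotr a x)); last first.
  by apply/funext => x; exact: pE.
apply: continuousTM; first exact: cst_continuous.
by move=> x; apply: continuous_comp; [exact: continuous_dotr|exact: ch'].
Qed.

Lemma continuous_Nsin : continuous (fun t : R => - sin t).
Proof. by move=> t; apply: continuousN; exact: continuous_sin. Qed.

Definition C1_cos n (a : 'cV[R]_n) := C1_dotr a continuous_Nsin (@is_derive_cos R).
Definition C1_sin n (a : 'cV[R]_n) := C1_dotr a (@continuous_cos R) (@is_derive_sin R).

Lemma cC1_expi n (a : 'cV[R]_n) : cC1 (fun x => expi (dotr a x)).
Proof. by split; [exact: (C1_cos a).1|exact: (C1_sin a).1]. Qed.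

Lemma cpartial_expi n (a : 'cV[R]_n) l x :
  cpartial l (fun x => expi (dotr a x)) x = (0 +i* a l ord0) * expi (dotr a x).
Proof.
apply: complexP; rewrite ?Re_mul ?Im_mul /=.
  by rewrite (C1_cos a).2; ring.
by rewrite (C1_sin a).2; ring.
Qed.

Lemma partialP_expi n (M : 'M[R]_(3, n)) (a : 'cV[R]_n) i x :
  partialP M i (fun x => expi (dotr a x)) x =
  (0 +i* (M *m a) i ord0) * expi (dotr a x).
Proof.
rewrite /partialP; under eq_bigr do rewrite cpartial_expi mulrA.
rewrite -big_distrl /=; congr (_ * _); rewrite mxE.
elim: (index_enum _) => [|l r IHr]; first by rewrite !big_nil.
rewrite !big_cons IHr; apply: complexP; rewrite ?Re_add ?Im_add ?Re_mul ?Im_mul /=; ring.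
Qed.

(** The frequencies form a list and the coefficients a function on all of R^n, of which only the
    values on [s] count. Repeated frequencies are allowed; [uniq s] is required where the
    coefficients must be determined by the function. *)
Definition tpoly n (s : seq 'cV[R]_n) (c : 'cV[R]_n -> C) : 'cV[R]_n -> C :=
  fun x => \sum_(a <- s) c a * expi (dotr a x).

Definition tfield n (s : seq 'cV[R]_n) (c : 'cV[R]_n -> 'cV[C]_3) :
    'cV[R]_n -> 'cV[C]_3 :=
  fun x => \sum_(a <- s) expi (dotr a x) *: c a.

Section fixed_dim.
Variable n : nat.
Implicit Types (s : seq 'cV[R]_n) (M : 'M[R]_(3, n)).

Lemma tfieldE s c j : (fun x => tfield s c x j ord0) = tpoly s (fun a => c a j ord0).
Proof.
apply/funext => x; rewrite /tfield summxE; apply: eq_bigr => a _.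
by rewrite mxE mulrC.
Qed.

Lemma tpolyB s c c' :
  (fun x => tpoly s c x - tpoly s c' x) = tpoly s (fun a => c a - c' a).
Proof.
apply/funext => x; rewrite /tpoly -sumrB; apply: eq_bigr => a _.
by rewrite mulrBl.
Qed.

Lemma cC1_tpoly s c : cC1 (tpoly s c).
Proof.
by apply: cC1_sum => a; apply: cC1M; [exact: cC1_cst|exact: cC1_expi].
Qed.

Lemma cC1_tfield s c : cC1_field (tfield s c).
Proof. by move=> j; rewrite tfieldE; exact: cC1_tpoly. Qed.

Lemma partialP_tpoly M i s c :
  partialP M i (tpoly s c) = tpoly s (fun a => (0 +i* (M *m a) i ord0) * c a).
Proof.
apply/funext => x; rewrite /tpoly partialP_sum.
  apply: eq_bigr => a _.
  by rewrite (partialPZ _ _ _ _ (cC1_expi a)) partialP_expi mulrCA mulrA.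
by move=> a; apply: cC1M; [exact: cC1_cst|exact: cC1_expi].
Qed.

Lemma divergence_tfield M s c x : divergence (partialP M) (tfield s c) x =
  tpoly s (fun a => (0 +i* 1) * \sum_j ((M *m a) j ord0)%:C * c a j ord0) x.
Proof.
rewrite /divergence; under eq_bigr do rewrite tfieldE partialP_tpoly.
rewrite /tpoly exchange_big/=; apply: eq_bigr => a _.
rewrite -big_distrl big_distrr/=; congr (_ * _); apply: eq_bigr => j _.
rewrite mulrA; congr (_ * _).
by apply: complexP; rewrite ?Re_mul ?Im_mul /=; ring.
Qed.

(** The coefficients are left unspecified: membership of the curl in the L2 spaces depends only on
    the frequencies, which stay the same. *)
Lemma curl_tfield M s c j :
  exists c', (fun x => curl (partialP M) (tfield s c) x j ord0) = tpoly s c'.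
Proof.
have pB i k (i' k' : nat) : exists c', (fun x =>
    partialP M i (comp3 (tfield s c) i') x - partialP M k (comp3 (tfield s c) k') x) =
    tpoly s c'.
  by rewrite /comp3 !tfieldE !partialP_tpoly tpolyB; eexists.
case: j => -[|[|[|//]]] j3.
- by have [c' cE] := pB (inord 1) (inord 2) 2 1; exists c'; rewrite -cE;
    apply/funext => x; rewrite mxE.
- by have [c' cE] := pB (inord 2) (inord 0) 0 2; exists c'; rewrite -cE;
    apply/funext => x; rewrite mxE.
- by have [c' cE] := pB (inord 0) (inord 1) 1 0; exists c'; rewrite -cE;
    apply/funext => x; rewrite mxE.
Qed.

(* Artin's argument: translating the relation by [y] and subtracting the value at
   [y] of the first character times the relation removes its first term; [y] is
   chosen so that the characters [a] and [b] take opposite values at [y]. *)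
Lemma tpoly_indep s c : uniq s -> (forall x, tpoly s c x = 0) ->
  forall a, a \in s -> c a = 0.
Proof.
elim: s c => [//|b s IHs] c /= /andP[bs us] s0.
have cs a : a \in s -> c a = 0.
  move=> sa; have ab : a - b != 0.
    by apply: contraNneq bs => /subr0_eq <-.
  (* The scaling makes <a - b, y> equal to pi; the denominator is nonzero because [a] and [b]
     differ. *)
  pose t := pi / dotr (a - b) (a - b); pose y := t *: (a - b).
  have yE : expi (dotr a y) = - expi (dotr b y).
    have -> : dotr a y = dotr b y + pi.
      apply/eqP; rewrite addrC -subr_eq -dotrBl /y dotrZr /t divfK//.
      by apply: contraNneq ab => /dotr_eq0 ->.
    by rewrite expiD expipi mulrN1.
  have : c a * (expi (dotr a y) - expi (dotr b y)) = 0.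
    (* The induction hypothesis is used for the relation with modified coefficients, in which the
       term of [b] has cancelled. *)
    apply: (IHs (fun a => c a * (expi (dotr a y) - expi (dotr b y)))) => // x.
    have := congr2 (fun u v => u - expi (dotr b y) * v) (s0 (x + y)) (s0 x).
    rewrite mulr0 subr0 => <-.
    rewrite /tpoly !big_cons !dotrDr !expiD mulrDr opprD addrACA.
    rewrite [X in _ = X + _](_ : _ = 0) ?add0r; last by ring.
    rewrite big_distrr -sumrB; apply: eq_bigr => a' _ /=.
    by rewrite dotrDr expiD; ring.
  rewrite yE => /eqP; rewrite mulf_eq0 -opprD oppr_eq0 -mulr2n mulrn_eq0/=.
  by rewrite (negbTE (expi_neq0 _)) orbF => /eqP.
move=> a; rewrite inE => /orP[/eqP ->|]; last exact: cs.
(* All coefficients on [s] being zero, the relation at the origin reduces to [c b = 0]. *)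
have := s0 0; rewrite /tpoly big_cons big1_seq => [|a' /= /cs ->]; last by rewrite mul0r.
by rewrite dotr0r expi0 mulr1 addr0.
Qed.

End fixed_dim.
End trigonometric_polynomials.

(** * Mean values and conformity *)

Section mean_values.
Context {R : realType}.
Local Notation C := R[i].
Local Notation Re := complex.Re.
Local Notation Im := complex.Im.

(** The derivative may be replaced by its averaged increment, a difference of two values bounded by
    [K] over the length [2 * L], hence at most [K / L]; the other factor is the volume of the
    cube. *)
Lemma le_integral_box_partial n (l : 'I_n) (L K : R) (g : 'cV[R]_n -> R) :
  0 < L -> C1 g -> (forall x, `|g x| <= K) ->
  `|\int[lebesgue_col n]_(x in box n (- L) L) partial l g x| <= K / L * (2 * L) ^+ n.
Proof.
move=> L0 Cg gK.
have LL : - L < L by rewrite gtrN.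
pose h x := (g (upd x l L) - g (upd x l (- L))) / (L - - L).
have ch : continuous h.
  have cu s : continuous (fun x => g (upd x l s)).
    by move=> x; apply: continuous_comp; [exact: continuous_upd|exact: Cg.1].
  apply: continuousTM; last exact: cst_continuous.
  by apply: continuousTD => //; exact: continuousTN.
have mB : measurable (box n (- L) L) by exact: measurable_box.
have ih : (lebesgue_col n).-integrable (box n (- L) L) (EFin \o h).
  exact: integrable_box.
rewrite [X in `|X|](_ : _ = \int[lebesgue_col n]_(x in box n (- L) L) h x); last first.
  by rewrite /Rintegral integral_box_partial.
apply: le_trans (le_normr_Rintegral _ _) _ => //.
have -> : K / L * (2 * L) ^+ n =
    \int[lebesgue_col n]_(x in box n (- L) L) (K / L).
  rewrite Rintegral_cst// [X in fine X]lebesgue_box ?ltW//=.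
  by congr (_ * _ ^+ _); ring.
apply: le_Rintegral => //.
- exact: (integrable_norm ih).
- by apply: integrable_box; exact: cst_continuous.
move=> x _; rewrite /h normrM normfV opprK -mulr2n -[L *+ 2]mulr_natl.
rewrite [`|2 * L|]gtr0_norm ?mulr_gt0//.
rewrite ler_pdivrMr ?mulr_gt0// (_ : K / L * (2 * L) = K + K); last first.
  by field; rewrite gt_eqF.
exact: le_trans (ler_normB _ _) (lerD (gK _) (gK _)).
Qed.

Lemma mean_partial0 (l : 'I_3) (K : R) (g : 'cV[R]_3 -> R) :
  C1 g -> (forall x, `|g x| <= K) ->
  (2 * L) ^- 3 * \int[lebesgue_col 3]_(x in cube L) partial l g x @[L --> +oo]
    --> (0 : R).
Proof.
move=> Cg gK; apply/cvgr0Pnorm_lt => e e0.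
near=> L.
have L0 : 0 < L by near: L; exact: nbhs_pinfty_gt.
have L3 : 0 < (2 * L) ^+ 3 by rewrite exprn_gt0// mulr_gt0.
rewrite normrM normfV [`|_ ^+ 3|]gtr0_norm// mulrC ltr_pdivrMr//.
apply: le_lt_trans (le_integral_box_partial l L0 Cg gK) _.
(* After division by the volume it is enough that [K / e < L]. *)
rewrite ltr_pM2r// ltr_pdivrMr// mulrC -ltr_pdivrMr//.
by near: L; apply: nbhs_pinfty_gt; exact: num_real.
Unshelve. all: by end_near. Qed.

(** The value is existential because [L2_qp] asks only that a mean exists; in this form the property
    is stable under linear combinations. *)
Definition has_mean (f : 'cV[R]_3 -> C) := exists c, is_mean_value f c.

Lemma cube_averageE f L : cube_average f L =
  (((2 * L) ^- 3 * \int[lebesgue_col 3]_(x in cube L) Re (f x)) +i*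
   ((2 * L) ^- 3 * \int[lebesgue_col 3]_(x in cube L) Im (f x)) : C).
Proof.
rewrite /cube_average /cintegral; apply: complexP; rewrite ?Re_mul ?Im_mul /=.
  by rewrite mul0r subr0.
by rewrite mulr0 addr0.
Qed.

Lemma has_meanD f g : has_mean f -> has_mean g -> has_mean (fun x => f x + g x).
Proof.
move=> [c [intf f1 f2]] [d [intg g1 g2]]; exists (c + d).
have mc L : measurable (@cube R L) by exact: measurable_box.
have aE L : cube_average (fun x => f x + g x) L = cube_average f L + cube_average g L.
  by rewrite /cube_average cintegralD// mulrDr.
split => [L||].
- exact: cintegrableD.
- by under eq_fun do rewrite aE Re_add; rewrite Re_add; exact: cvgD.
- by under eq_fun do rewrite aE Im_add; rewrite Im_add; exact: cvgD.
Qed.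

Lemma has_meanZ (c : C) f : has_mean f -> has_mean (fun x => c * f x).
Proof.
move=> [d [intf f1 f2]]; exists (c * d).
have mc L : measurable (@cube R L) by exact: measurable_box.
have aE L : cube_average (fun x => c * f x) L = c * cube_average f L.
  by rewrite /cube_average cintegralZ// mulrCA.
split => [L||].
- exact: cintegrableZ.
- under eq_fun do rewrite aE Re_mul; rewrite Re_mul.
  by apply: cvgB; apply: cvgM => //; exact: cvg_cst.
- under eq_fun do rewrite aE Im_mul; rewrite Im_mul.
  by apply: cvgD; apply: cvgM => //; exact: cvg_cst.
Qed.

Lemma has_mean_cst1 : has_mean (fun=> 1).
Proof.
exists 1; split => [L||].
- by apply: cintegrable_box; exact: ccontinuous_cst.
(* The average is 1 only for [L > 0]: otherwise the cube is empty or a point and the average is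
   0. *)
- apply: cvg_near_cst; near=> L.
  have L0 : 0 < L by near: L; exact: nbhs_pinfty_gt.
  rewrite cube_averageE /= Rintegral_cst; last exact: measurable_box.
  rewrite [X in fine X]lebesgue_box; last by rewrite ltW// gtrN.
  rewrite /= mul1r opprK -mulr2n -[L *+ 2]mulr_natl mulVf//.
  by rewrite expf_neq0// gt_eqF// mulr_gt0.
- apply: cvg_near_cst; near=> L.
  rewrite cube_averageE /= Rintegral_cst; last exact: measurable_box.
  by rewrite mul0r mulr0.
Unshelve. all: by end_near. Qed.

(** For nonzero [a], some coordinate [a l ord0] is nonzero, and the real and imaginary parts are the
    [l]-th partial derivatives of the bounded functions sin<a, x> / a_l and - cos<a, x> / a_l, so
    their averages tend to 0. *)
Lemma has_mean_expi (a : 'cV[R]_3) : has_mean (fun x => expi (dotr a x)).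
Proof.
have [->|a0] := eqVneq a 0.
  by under eq_fun do rewrite dotr0l expi0; exact: has_mean_cst1.
have [l al] : exists l, a l ord0 != 0.
  apply: contrapT => /forallNP al; move/eqP : a0; apply; apply/colP => l.
  by rewrite mxE; apply: contrapT => /eqP; exact: al.
have [Cs sE] := C1_sin a; have [Cc cE] := C1_cos a.
pose c : R := (a l ord0)^-1.
exists 0; split => [L||].
- by apply: cintegrable_box; exact/cC1_ccontinuous/cC1_expi.
- under eq_fun do rewrite cube_averageE /=.
  have cosE : (fun x => cos (dotr a x)) = partial l (fun x => c * sin (dotr a x)).
    apply/funext => x; rewrite (partialM _ _ (C1_cst _ c) Cs).
    by rewrite partial_cst sE mulr0 addr0 mulKf.
  rewrite cosE; apply: (@mean_partial0 _ `|c|) => [|x]; first exact: C1M (C1_cst _ c) Cs.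
  by rewrite normrM ler_piMr// ler_norml sin_geN1 sin_le1.
- under eq_fun do rewrite cube_averageE /=.
  have sinE : (fun x => sin (dotr a x)) = partial l (fun x => - c * cos (dotr a x)).
    apply/funext => x; rewrite (partialM _ _ (C1_cst _ (- c)) Cc).
    by rewrite partial_cst cE mulr0 addr0 mulrN mulrNN mulKf.
  rewrite sinE; apply: (@mean_partial0 _ `|- c|) => [|x].
    exact: C1M (C1_cst _ _) Cc.
  by rewrite normrM ler_piMr// ler_norml cos_geN1 cos_le1.
Qed.

Lemma has_mean_sum (I : Type) (r : seq I) (F : I -> 'cV[R]_3 -> C) :
  (forall i, has_mean (F i)) -> has_mean (fun x => \sum_(i <- r) F i x).
Proof.
move=> mF; elim: r => [|i r IHr].
  under eq_fun do rewrite big_nil.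
  have := has_meanZ 0 has_mean_cst1.
  by under eq_fun do rewrite mul0r.
by under eq_fun do rewrite big_cons; exact: has_meanD.
Qed.

Lemma cmeasurable_ccontinuous n (f : 'cV[R]_n -> C) : ccontinuous f -> cmeasurable f.
Proof. by move=> [f1 f2]; split; exact: continuous_measurable_col. Qed.

Lemma conj_expi (t : R) : ((expi t)^*)%C = expi (- t).
Proof. by rewrite /expi cosN sinN. Qed.

(** * Trigonometric polynomials in the L2 spaces *)

Section tpoly_spaces.
Variables (n : nat) (P : 'M[R]_(3, n)).

(** For q = P k one has <q, z> = <k, P^T z>, which gives the parent function with integer
    frequencies. The squared modulus is a finite double sum of characters of frequencies a - b, each
    of which has a mean. *)
Lemma L2_qp_tpoly s c : (forall q, q \in s -> Zcol P q) -> L2_qp P (tpoly s c).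
Proof.
move=> sP; split.
- have /choice[k kP] : forall q, exists k : 'cV[int]_n, q \in s -> q = phi P k.
    move=> q; have [/sP[k _ <-]|] := boolP (q \in s); first by exists k.
    (* A default value for vectors that are not frequencies. *)
    by exists 0.
  exists (fun x => \sum_(q <- s) c q * expi (dotr (map_mx intr (k q)) x)); split.
    move=> x l; apply: eq_bigr => q _; congr (_ * _).
    by rewrite dotrDr dotrZr dotr_unitv mxE expiD expi2pi mulr1.
  move=> z; apply: eq_big_seq => q /kP qE.
  by rewrite {2}qE /phi dotr_mulmx.
- exact/cmeasurable_ccontinuous/cC1_ccontinuous/cC1_tpoly.
- suff [d dP] : has_mean (fun z => tpoly s c z * (tpoly s c z)^*) by exists d.
  rewrite (_ : (fun z => _) = fun z => \sum_(a <- s) \sum_(b <- s)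
      c a * (c b)^* * expi (dotr (a - b) z)).
    apply: has_mean_sum => a; apply: has_mean_sum => b.
    by apply: has_meanZ; exact: has_mean_expi.
  apply/funext => z; rewrite /tpoly big_distrl/=; apply: eq_bigr => a _.
  rewrite rmorph_sum big_distrr/=; apply: eq_bigr => b _.
  rewrite rmorphM dotrBl expiD -conj_expi; ring.
Qed.

Lemma L2_per_tpoly s c :
  (forall a, a \in s -> exists k : 'cV[int]_n, a = map_mx intr k :> 'cV[R]_n) ->
  L2_per (tpoly s c : 'cV[R]_n -> C).
Proof.
move=> sZ.
have [cR cI] := cC1_ccontinuous (cC1_tpoly s c).
split.
- move=> x l; apply: eq_big_seq => a /sZ[k ->]; congr (_ * _).
  by rewrite dotrDr dotrZr dotr_unitv mxE expiD expi2pi mulr1.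
- exact: cmeasurable_ccontinuous.
(* The squared modulus as a real continuous function, hence integrable on the torus, which is a
   bounded box. *)
pose h x := Re (tpoly s c x) * Re (tpoly s c x) + Im (tpoly s c x) * Im (tpoly s c x).
have ch : continuous h by apply: continuousTD; exact: continuousTM.
rewrite (_ : (fun x => _) = EFin \o h).
  apply: integrable_lty; first exact: measurable_box.
  exact: (integrable_box 0 (2 * pi) ch).
apply/funext => x; rewrite /h /=; congr (_%:E).
case: (tpoly s c x) => u v /=; rewrite sqr_sqrtr -?expr2//.
by rewrite addr_ge0// sqr_ge0.
Qed.

End tpoly_spaces.
End mean_values.

(** * Divergence-free spaces *)

Section linear_spans.
Context {K : nzRingType} {V : lmodType K}.
Implicit Types (S T : set V) (v w : V).

Lemma lin_span0 S : lin_span S 0.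
Proof.
by exists 0%N, (fun=> 0), (fun=> 0); split => [[]//|]; rewrite big_ord0.
Qed.

Lemma lin_span_cons S c w v : S w -> lin_span S v -> lin_span S (c *: w + v).
Proof.
move=> Sw [m [d [x [Sx ->]]]].
exists m.+1, (fun i => if unlift ord0 i is Some j then d j else c),
  (fun i => if unlift ord0 i is Some j then x j else w); split.
  by move=> i; case: unlift.
rewrite big_ord_recl unlift_none; congr (_ + _); apply: eq_bigr => i _.
by rewrite liftK.
Qed.

Lemma lin_span_ind S (Q : V -> Prop) :
  Q 0 -> (forall c w v, S w -> Q v -> Q (c *: w + v)) ->
  forall v, lin_span S v -> Q v.
Proof.
move=> Q0 QS v [m [c [w [Sw ->]]]].
by elim/big_rec : _ => // i x _ Qx; exact: QS.
Qed.

Lemma lin_spanD S v w : lin_span S v -> lin_span S w -> lin_span S (v + w).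
Proof.
move=> + Sw; move: v; apply: lin_span_ind; first by rewrite add0r.
by move=> c x v Sx IH; rewrite -addrA; exact: lin_span_cons.
Qed.

End linear_spans.

(** * Spans of one-frequency fields as sets of trigonometric fields *)

Section divergence_free_spaces.
Context {R : realType}.
Local Notation C := R[i].
Variable n : nat.
Implicit Types (Q : 'cV[R]_n -> 'cV[C]_3 -> Prop) (u : 'cV[R]_n -> 'cV[C]_3).

(** [Q] constrains a frequency together with its coefficient: it can restrict the frequencies only,
    or also put each coefficient in a null space. Distinct frequencies make the independence of
    characters applicable. *)
Definition trig_field Q u := exists s c,
  [/\ uniq s, forall a, a \in s -> Q a (c a) & u = tfield s c].

Lemma trig_field0 Q : trig_field Q 0.
Proof.
exists [::], (fun=> 0); split => //.
by apply/funext => x; rewrite /tfield big_nil.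
Qed.

(** To keep the frequencies distinct, the new coefficient is added to the old one when [a] already
    occurs, which is where stability of [Q a] under sums enters; otherwise [a] is put in front. *)
Lemma trig_field_cons Q a v u :
  (forall a v w, Q a v -> Q a w -> Q a (v + w)) ->
  Q a v -> trig_field Q u ->
  trig_field Q (fun x => expi (dotr a x) *: v + u x).
Proof.
move=> QD Qv [s [c [us Qs ->]]].
have [sa|sa] := boolP (a \in s).
  exists s, (fun b => if b == a then v + c b else c b); split => //.
    move=> b sb; case: eqP => [ba|_]; last exact: Qs.
    by rewrite ba; apply: QD => //; exact: Qs.
  apply/funext => x; rewrite /tfield (big_rem a)//= [in RHS](big_rem a)//= eqxx.
  rewrite scalerDr -addrA; congr (_ + (_ + _)); apply: eq_big_seq => b.
  by rewrite mem_rem_uniq// inE => /andP[/negbTE ->].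
exists (a :: s), (fun b => if b == a then v else c b); split => /=.
- by rewrite sa.
- move=> b; rewrite inE; case: eqP => [->//|_ /=]; exact: Qs.
- apply/funext => x; rewrite /tfield big_cons eqxx; congr (_ + _).
  apply: eq_big_seq => b sb; case: eqP => // ba.
  by move: sa; rewrite -ba sb.
Qed.

(** The span can be computed frequency by frequency: it suffices that each [Q a] is closed under
    combinations, that every generator has one frequency and an allowed coefficient, and that the
    generators span all allowed one-frequency fields. *)
Lemma trig_field_span (Q : 'cV[R]_n -> 'cV[C]_3 -> Prop)
    (S : set ('cV[R]_n -> 'cV[C]_3)) :
  (forall a c v w, Q a v -> Q a w -> Q a (c *: v + w)) ->
  (forall u, S u -> exists a v, Q a v /\ u = fun x => expi (dotr a x) *: v) ->
  (forall a v, Q a v -> lin_span S (fun x => expi (dotr a x) *: v)) ->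
  lin_span S = [set u | trig_field Q u].
Proof.
move=> QL SQ QS; apply/seteqP; split.
  apply: lin_span_ind; first exact: trig_field0.
  move=> c w u /SQ[a [v [Qv ->]]] Qu.
  (* The closure hypothesis gives 0 as -v + v, and with it the stability under scaling used next. *)
  have Q0 : Q a 0 by have := QL a (-1) v v Qv Qv; rewrite scaleN1r addNr.
  rewrite (_ : _ + _ = fun x => expi (dotr a x) *: (c *: v) + u x).
    apply: trig_field_cons => //; last by rewrite -[_ *: _]addr0; exact: QL.
    by move=> a' v' w' Qv' Qw'; rewrite -[v']scale1r; exact: QL.
  by apply/funext => x; rewrite /= scalerA mulrC -scalerA.
move=> _ [s [c [_ Qs ->]]].
elim: s Qs => [|a s IHs] Qs.
  rewrite (_ : tfield _ _ = 0); first exact: lin_span0.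
  by apply/funext => x; rewrite /tfield big_nil.
rewrite (_ : tfield _ _ = (fun x => expi (dotr a x) *: c a) + tfield s c).
  apply: lin_spanD; first by apply/QS/Qs; rewrite mem_head.
  by apply: IHs => b sb; apply: Qs; rewrite inE sb orbT.
by apply/funext => x; rewrite /tfield big_cons.
Qed.

(** The unit vectors span C^3, so the coefficient at a frequency of [A] is arbitrary. *)
Lemma span_unit_trig_field (A : set 'cV[R]_n) :
  lin_span [set u : 'cV[R]_n -> 'cV[C]_3 | exists j a, A a /\
    u = fun x => expi (dotr a x) *: delta_mx j ord0] =
  [set u | trig_field (fun a _ => A a) u].
Proof.
apply: trig_field_span => //.
  by move=> u [j [a [Aa ->]]]; exists a, (delta_mx j ord0).
move=> a v Aa.
rewrite (_ : (fun x => _) = fun x =>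
    \sum_j v j ord0 *: (expi (dotr a x) *: delta_mx j ord0)).
  elim: (index_enum _) => [|j r IHr].
    rewrite [X in lin_span _ X](_ : _ = 0); first exact: lin_span0.
    by apply/funext => x; rewrite big_nil.
  rewrite [X in lin_span _ X](_ : _ =
    v j ord0 *: (fun x => expi (dotr a x) *: delta_mx j ord0) +
    fun x => \sum_(j <- r) v j ord0 *: (expi (dotr a x) *: delta_mx j ord0)).
    by apply: lin_span_cons => //; exists j, a.
  by apply/funext => x; rewrite big_cons.
apply/funext => x; rewrite {1}[v]matrix_sum_delta scaler_sumr; apply: eq_bigr => j _.
by rewrite big_ord_recl big_ord0 addr0 !scalerA mulrC.
Qed.

Lemma null_spaceP (q : 'cV[R]_3) c (v w : 'cV[C]_3) :
  null_space q v -> null_space q w -> null_space q (c *: v + w).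
Proof.
rewrite /null_space /= => v0 w0.
under eq_bigr do rewrite !mxE mulrDr mulrCA.
by rewrite big_split -big_distrr/= v0 w0 mulr0 addr0.
Qed.

Lemma div0_trig_field (M : 'M[R]_(3, n)) (A : set 'cV[R]_n) :
  [set u | trig_field (fun a _ => A a) u /\
           forall x, divergence (partialP M) u x = 0] =
  [set u | trig_field (fun a v => A a /\ null_space (M *m a) v) u].
Proof.
apply/seteqP; split=> u.
  move=> [[s [c [us As ->]]] div0]; exists s, c; split => // a sa; split; first exact: As.
  (* The divergence is a trigonometric polynomial with distinct frequencies, so each coefficient i
     (M a . c_a) is zero, and the factor i can be cancelled. *)
  have := tpoly_indep us (fun x => etrans (esym (divergence_tfield M s c x)) (div0 x)) sa.
  by move=> /eqP; rewrite mulf_eq0 eq_complex/= oner_eq0 andbF/= => /eqP.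
move=> [s [c [us As ->]]]; split.
  by exists s, c; split => // a /As[].
move=> x; rewrite divergence_tfield /tpoly big1_seq// => a /= /As[_ cn].
by rewrite [X in _ * X * _]cn mulr0 mul0r.
Qed.

(* [L] is the symbol [M *m _], up to propositional equality only, so that the
   type of [d] need not be transported. *)
Lemma div0_span (M : 'M[R]_(3, n)) (L : 'cV[R]_n -> 'cV[R]_3) (A : set 'cV[R]_n)
    (d : forall q : 'cV[R]_3, 'I_(null_dim q) -> 'cV[C]_3) :
  (forall a, L a = M *m a) ->
  (forall a, A a -> orthonormal_basis (d (L a)) (null_space (L a))) ->
  [set u | lin_span [set u | exists j a, A a /\
             u = fun x => expi (dotr a x) *: delta_mx j ord0] u /\
           forall x, divergence (partialP M) u x = 0] =
  lin_span [set u | exists a (j : 'I_(null_dim (L a))), A a /\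
             u = fun x => expi (dotr a x) *: d (L a) j].
Proof.
move=> LM dA; rewrite span_unit_trig_field div0_trig_field.
apply/esym/trig_field_span.
- by move=> a c v w [Aa v0] [_ w0]; split => //; exact: null_spaceP.
- move=> u [a [j [Aa ->]]]; exists a, (d (L a) j); split => //; split => //.
  (* A basis vector lies in the null space as a one-term combination of the basis. *)
  rewrite -LM -(dA _ Aa).2 -[d _ _]addr0 -[X in X + _]scale1r.
  by apply: lin_span_cons; [exists j|exact: lin_span0].
(* Conversely, a vector of the null space is expanded in the basis, and the character distributes
   over the expansion. *)
- move=> a v [Aa]; rewrite -LM -(dA _ Aa).2; move: v; apply: lin_span_ind.
    rewrite [X in lin_span _ X](_ : _ = 0); first exact: lin_span0.
    by apply/funext => x; rewrite scaler0.
  move=> c _ v [j _ <-] IH.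
  rewrite [X in lin_span _ X](_ : _ = c *: (fun x => expi (dotr a x) *: d (L a) j) +
    fun x => expi (dotr a x) *: v); first by apply: lin_span_cons => //; exists a, j.
  by apply/funext => x; rewrite scalerDr scalerA mulrC -scalerA.
Qed.

End divergence_free_spaces.

(** * Conformity in the two curl spaces *)

Section conformity.
Context {R : realType}.
Local Notation C := R[i].
Variables (n N : nat) (P : 'M[R]_(3, n)).

(** Integer frequencies are reindexed as real vectors, the form that the general results on spans
    take. *)
Lemma HN_perE : @HN_per R n N =
  lin_span [set u | exists j a, (map_mx intr @` I_per N) a /\
    u = fun x => expi (dotr a x) *: delta_mx j ord0].
Proof.
rewrite /HN_per; congr lin_span; apply/seteqP; split => u.
  by move=> [j [k [Ik ->]]]; exists j, (map_mx intr k); split => //; exists k.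
by move=> [j [_ [[k Ik <-] ->]]]; exists j, k.
Qed.

(** The witness for the weak curl is the classical one: it has the same frequencies, hence lies in
    [L2_qp3], and compactly supported test fields produce no boundary terms. *)
Lemma HN_qp_Hcurl : HN_qp P N `<=` Hcurl_qp P.
Proof.
rewrite /HN_qp span_unit_trig_field => _ [s [c [us As ->]]].
have sP q : q \in s -> Zcol P q by move=> /As[k _ <-]; exists k.
split; first by move=> j; rewrite tfieldE; exact: L2_qp_tpoly.
exists (curl (partialP 1%:M) (tfield s c)).
  by move=> j; have [c' ->] := curl_tfield 1%:M s c j; exact: L2_qp_tpoly.
by rewrite -partialP1; apply: weak_curl_supp; exact: cC1_tfield.
Qed.

Lemma HN_per_Hcurl : @HN_per R n N `<=` Hcurl_per P.
Proof.
rewrite HN_perE span_unit_trig_field => _ [s [c [us As ->]]].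
have sZ a : a \in s -> exists k : 'cV[int]_n, a = map_mx intr k.
  by move=> /As[k _ <-]; exists k.
split; first by move=> j; rewrite tfieldE; exact: L2_per_tpoly.
exists (curl (partialP P) (tfield s c)).
  by move=> j; have [c' ->] := curl_tfield P s c j; exact: L2_per_tpoly.
apply: weak_curl_per; first exact: cC1_tfield.
(* The field is periodic because a shift by 2 pi multiplies a character of integer frequency by
   exp(2 pi i k_l) = 1. *)
move=> x l; apply: eq_big_seq => a /sZ[k ->].
by rewrite dotrDr dotrZr dotr_unitv mxE expiD expi2pi mulr1.
Qed.

End conformity.

Theorem theorem2 (R : realType) (n N : nat) (P : 'M[R]_(3, n))
    (d : forall q : 'cV[R]_3, 'I_(null_dim q) -> 'cV[R[i]]_3) :
  (0 < N)%N ->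
  rationally_independent_columns P ->
  (forall q, Zcol P q -> orthonormal_basis (d q) (null_space q)) ->
  [/\ forall u, Vdiv0_qp P N u ->
        forall z, divergence (@cpartial R 3) u z = 0,
      Vdiv0_qp P N `<=` Hcurl_qp P &
      Vdiv0_qp P N =
        lin_span [set psi : 'cV[R]_3 -> 'cV[R[i]]_3 |
          exists (q : 'cV[R]_3) (j : 'I_(null_dim q)),
            I_qp P N q /\ psi = (fun z => expi (dotr q z) *: d q j)]]
  /\
  [/\ forall U, Vdiv0_per P N U ->
        forall x, divergence (partialP P) U x = 0,
      Vdiv0_per P N `<=` Hcurl_per P &
      Vdiv0_per P N =
        lin_span [set Psi : 'cV[R]_n -> 'cV[R[i]]_3 |
          exists (k : 'cV[int]_n) (j : 'I_(null_dim (phi P k))),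
            I_per N k /\
            Psi = (fun x => expi (dotr (map_mx intr k) x) *: d (phi P k) j)]].
Proof.
move=> _ _ dP; split; split.
- by move=> u [].
- by move=> u [/HN_qp_Hcurl].
- rewrite /Vdiv0_qp /HN_qp -partialP1.
  (* Taking the identity for [L] rather than multiplication by the unit matrix keeps the basis in
     the form [d q]. *)
  rewrite (div0_span (L := id) (d := d))//; first by move=> a; rewrite mul1mx.
  by move=> _ [k _ <-]; apply: dP; exists k.
- by move=> u [].
- by move=> u [/HN_per_Hcurl].
(* Here the symbol at an integer vector [k] is [P *m map_mx intr k], which is [phi P k] by
   definition. *)
- rewrite /Vdiv0_per HN_perE (div0_span (L := fun a => P *m a) (d := d))//; last first.
    by move=> _ [k _ <-]; apply: dP; exists k.
  (* It remains to pass from real frequencies in the image of [I_per] back to integer indices. *)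
  congr lin_span; apply/seteqP; split => u.
    by move=> [a [j [[k Ik ka] ->]]]; subst a; exists k, j.
  by move=> [k [j [Ik ->]]]; exists (map_mx intr k), j; split => //; exists k.
Qed.
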